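(* Let $Q$ be a hyperbolic set of the control system $\Sigma$ and assume that its all-time lift $L(Q)$ is an isolated invariant set of the control flow. Then all fibers $Q(u)$, $u\in\mathcal U$, are nonempty and homeomorphic to each other.
   Context: Setting: $\Sigma: x_{t+1}=f(x_t,u_t)$ with $f:M\times U\to M$, where $M$ is a connected smooth finite-dimensional manifold with a fixed Riemannian metric (norm $|\cdot|$, distance $d$), $U$ is a compact connected metric space, each $f_u:=f(\cdot,u)$ is a $C^1$-diffeomorphism of $M$ whose derivative depends jointly continuously on $(u,x)$, and $f$ and $(x,u)\mapsto f_u^{-1}(x)$ are continuous. $\mathcal U:=U^{\mathbb Z}$ has the product topology, $(\theta u)_t:=u_{t+1}$ is the left shift. The transition map is $\varphi(t,x,u)=\varphi_{t,u}(x)=f_{u_{t-1}}\circ\cdots\circ f_{u_0}(x)$ for $t>0$, $\varphi(0,x,u)=x$, $\varphi(t,x,u)=f_{u_t}^{-1}\circ\cdots\circ f_{u_{-1}}^{-1}(x)$ for $t<0$. The control flow is $\Phi_t(u,x)=(\theta^tu,\varphi(t,x,u))$ on $\mathcal U\times M$, $t\in\mathbb Z$. $Q\subset M$ is all-time controlled invariant if for every $x\in Q$ there is $u\in\mathcal U$ with $\varphi(\mathbb Z,x,u)\subset Q$. $L(Q):=\{(u,x):\varphi(\mathbb Z,x,u)\subset Q\}$, $Q(u):=\{x:(u,x)\in L(Q)\}$. A closed invariant set $A$ of $\Phi$ is isolated invariant if it has a neighborhood $N$ such that $\Phi_t(z)\in N$ for all $t\in\mathbb Z$ implies $z\in A$.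 Hyperbolic: $Q$ is nonempty, compact, all-time controlled invariant, and for every $(u,x)\in L(Q)$ there is a splitting $T_xM=E^-(u,x)\oplus E^+(u,x)$ with (i) $\mathrm D\varphi_{t,u}(x)E^\pm(u,x)=E^\pm(\Phi_t(u,x))$ for all $t\in\mathbb Z$; (ii) there are $c\ge1$, $\lambda\in(0,1)$ with $|\mathrm D\varphi_{t,u}(x)v|\le c\lambda^t|v|$ for $v\in E^-(u,x)$ and $|\mathrm D\varphi_{-t,u}(x)v|\le c\lambda^t|v|$ for $v\in E^+(u,x)$, for all $(u,x)\in L(Q)$, $t\ge0$; (iii) $\dim E^\pm(u,x)$ are constant on $L(Q)$. *)

(* Defs.v *)
From HB Require Import structures.
From mathcomp Require Import all_boot all_order all_algebra.
From mathcomp Require Import all_classical all_reals all_analysis.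

Set Implicit Arguments.
Unset Strict Implicit.
Unset Printing Implicit Defensive.

Import Order.TTheory GRing.Theory Num.Theory.
Import numFieldNormedType.Exports.

Local Open Scope classical_set_scope.
Local Open Scope ring_scope.

(* [f] is of class C^k at the points of [O]; meant for open [O]. In finite
   dimension, continuity of all iterated directional derivatives is continuity
   of the derivatives as multilinear maps. *)
Fixpoint class_C (R : realType) (V W : normedModType R) (k : nat) (O : set V)
    (f : V -> W) : Prop :=
  match k with
  | 0 => forall x, O x -> {for x, continuous f}
  | k'.+1 => (forall x, O x -> differentiable f x) /\
             (forall v, class_C k' O (fun x => 'D_v f x))
  end.

Definition smooth_on (R : realType) (V W : normedModType R) (O : set V)
    (f : V -> W) : Prop :=
  forall k, class_C k O f.

(* [cmap] and [cinv] are total functions; only their restrictions to [cdom]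
   and to its image matter. *)
Record chart (R : realType) (n : nat) (M : topologicalType) := Chart {
  cdom : set M ;
  cmap : M -> 'rV[R]_n ;
  cinv : 'rV[R]_n -> M ;
  cdom_open : open cdom ;
  crange_open : open (cmap @` cdom) ;
  cmapK : forall x, cdom x -> cinv (cmap x) = x ;
  cmap_continuous : forall x, cdom x -> {for x, continuous cmap} ;
  cinv_continuous : forall x, cdom x -> {for cmap x, continuous cinv}
}.

(* A C^oo atlas on [M] modelled on R^n, with a chosen chart around each point.

   The tangent space at [x] is 'rV[R]_n, a tangent vector being represented by
   its coordinates in the chart [chart_at x]. *)
Record smooth_manifold (R : realType) (n : nat) (M : topologicalType) :=
  SmoothManifold {
  charts : set (chart R n M) ;
  chart_at : M -> chart R n M ;
  chart_at_charts : forall x, charts (chart_at x) ;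
  chart_at_dom : forall x, cdom (chart_at x) x ;
  charts_compat : forall c c', charts c -> charts c' ->
    smooth_on (cmap c @` (cdom c `&` cdom c')) (cmap c' \o cinv c) ;
  manifold_hausdorff : hausdorff_space M ;
  manifold_second_countable : @second_countable M
}.

(* The element of the tangent space at [p] whose coordinates in the chart [c]
   around [p] are [v]. *)
Definition tangent_of_chart (R : realType) (n : nat) (M : topologicalType)
    (A : smooth_manifold R n M) (c : chart R n M) (p : M) (v : 'rV[R]_n)
    : 'rV[R]_n :=
  'd (cmap (chart_at A p) \o cinv c) (cmap c p) v.

(* The differential of [F] at [x], from the tangent space at [x] to the tangent
   space at [F x]. *)
Definition mdiff (R : realType) (n : nat) (M : topologicalType)
    (A : smooth_manifold R n M) (F : M -> M) (x : M)
    : 'Hom('rV[R]_n, 'rV[R]_n) :=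
  linfun ('d (cmap (chart_at A (F x)) \o F \o cinv (chart_at A x))
             (cmap (chart_at A x) x)).

Definition C1_map (R : realType) (n : nat) (M : topologicalType)
    (A : smooth_manifold R n M) (F : M -> M) : Prop :=
  continuous F /\
  forall c c', charts A c -> charts A c' ->
    class_C 1 (cmap c @` (cdom c `&` F @^-1` cdom c'))
      (cmap c' \o F \o cinv c).

Record riemannian_metric (R : realType) (n : nat) (M : topologicalType)
    (A : smooth_manifold R n M) := RiemannianMetric {
  rinner : M -> 'rV[R]_n -> 'rV[R]_n -> R ;
  rinner_linear : forall x a v v' w,
    rinner x (a *: v + v') w = a * rinner x v w + rinner x v' w ;
  rinner_sym : forall x v w, rinner x v w = rinner x w v ;
  rinner_pos : forall x v, v != 0 -> 0 < rinner x v v ;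
  rinner_smooth : forall c, charts A c -> forall v w : 'rV[R]_n,
    smooth_on (cmap c @` cdom c)
      (fun y => rinner (cinv c y) (tangent_of_chart A c (cinv c y) v)
                                  (tangent_of_chart A c (cinv c y) w) : R^o)
}.

Definition rnorm (R : realType) (n : nat) (M : topologicalType)
    (A : smooth_manifold R n M) (g : riemannian_metric A) (x : M)
    (v : 'rV[R]_n) : R :=
  Num.sqrt (rinner g x v v).

Record control_system (R : realType) (n : nat) (M : topologicalType)
    (A : smooth_manifold R n M) (U : topologicalType) := ControlSystem {
  rhs : M -> U -> M ;
  rhs_inv : M -> U -> M ;
  rhsK : forall u, cancel (rhs^~ u) (rhs_inv^~ u) ;
  rhs_invK : forall u, cancel (rhs_inv^~ u) (rhs^~ u) ;
  rhs_continuous : continuous (fun p : M * U => rhs p.1 p.2) ;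
  rhs_inv_continuous : continuous (fun p : M * U => rhs_inv p.1 p.2) ;
  rhs_C1 : forall u, C1_map A (rhs^~ u) ;
  rhs_inv_C1 : forall u, C1_map A (rhs_inv^~ u) ;
  rhs_diff_continuous : forall c c', charts A c -> charts A c' ->
    forall (v : 'rV[R]_n) (u : U) (x : M),
      cdom c x -> cdom c' (rhs x u) ->
      {for (u, cmap c x), continuous (fun p : U * 'rV[R]_n =>
        'd (cmap c' \o rhs^~ (p.1) \o cinv c) (p.2) v)}
}.

(* Bi-infinite control sequences, with the product topology. *)
Definition control_seq (U : topologicalType) : topologicalType :=
  {ptws int -> U}.

Section ControlFlow.
Variables (R : realType) (n : nat) (M : topologicalType).
Variables (A : smooth_manifold R n M) (U : topologicalType).
Variable S : control_system A U.

Fixpoint phi_fwd (t : nat) (x : M) (u : control_seq U) : M :=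
  match t with
  | 0 => x
  | t'.+1 => rhs S (phi_fwd t' x u) (u t'%:Z)
  end.

Fixpoint phi_bwd (t : nat) (x : M) (u : control_seq U) : M :=
  match t with
  | 0 => x
  | t'.+1 => rhs_inv S (phi_bwd t' x u) (u (- (t'.+1)%:Z))
  end.

(* [Negz t] is the integer - (t + 1). *)
Definition phi (t : int) (x : M) (u : control_seq U) : M :=
  match t with
  | Posz t' => phi_fwd t' x u
  | Negz t' => phi_bwd t'.+1 x u
  end.

(* The [t]-th iterate of the left shift. *)
Definition shift_seq (t : int) (u : control_seq U) : control_seq U :=
  fun s => u (s + t).

Definition control_flow (t : int) (z : control_seq U * M)
    : control_seq U * M :=
  (shift_seq t z.1, phi t z.2 z.1).

Definition all_time_controlled_invariant (Q : set M) : Prop :=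
  forall x, Q x -> exists u : control_seq U, forall t, Q (phi t x u).

Definition all_time_lift (Q : set M) : set (control_seq U * M) :=
  [set z | forall t, Q (phi t z.2 z.1)].

Definition fiber (Q : set M) (u : control_seq U) : set M :=
  [set x | all_time_lift Q (u, x)].

Definition isolated_invariant (L : set (control_seq U * M)) : Prop :=
  [/\ closed L,
      forall t z, L z -> L (control_flow t z)
    & exists N : set (control_seq U * M), L `<=` N° /\
        forall z, (forall t, N (control_flow t z)) -> L z].

Definition hyperbolic_set (g : riemannian_metric A) (Q : set M) : Prop :=
  [/\ Q !=set0, compact Q, all_time_controlled_invariant Q &
   exists Em Ep : control_seq U * M -> {vspace 'rV[R]_n},
   [/\ forall z, all_time_lift Q z ->
         (Em z + Ep z = fullv)%VS /\ (Em z :&: Ep z = 0)%VS,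
       forall (u : control_seq U) (x : M) (t : int),
         all_time_lift Q (u, x) ->
         (mdiff A (phi t ^~ u) x @: Em (u, x))%VS = Em (control_flow t (u, x))
         /\
         (mdiff A (phi t ^~ u) x @: Ep (u, x))%VS = Ep (control_flow t (u, x)),
       exists c lam : R, [/\ 1 <= c, 0 < lam < 1 &
         forall (u : control_seq U) (x : M) (t : nat),
         all_time_lift Q (u, x) ->
         (forall v, v \in Em (u, x) ->
            rnorm g (phi t%:Z x u) (mdiff A (phi t%:Z ^~ u) x v)
              <= c * lam ^+ t * rnorm g x v) /\
         (forall v, v \in Ep (u, x) ->
            rnorm g (phi (- t%:Z) x u) (mdiff A (phi (- t%:Z) ^~ u) x v)
              <= c * lam ^+ t * rnorm g x v)]
     & forall z z', all_time_lift Q z -> all_time_lift Q z' ->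
         \dim (Em z) = \dim (Em z') /\ \dim (Ep z) = \dim (Ep z')]].

End ControlFlow.

(* The subspaces [A] and [B] are homeomorphic; [h] and [k] are irrelevant
   outside [A] and [B]. *)
Definition homeomorphic (T T' : topologicalType) (A : set T) (B : set T')
    : Prop :=
  exists (h : T -> T') (k : T' -> T),
    [/\ (forall x, A x -> B (h x)) /\ (forall y, B y -> A (k y)),
        (forall x, A x -> k (h x) = x) /\ (forall y, B y -> h (k y) = y),
        {within A, continuous h} & {within B, continuous k}].

(* Main.v *)
Require Import Defs.
From HB Require Import structures.
From mathcomp Require Import all_boot all_order all_algebra.
From mathcomp Require Import all_classical all_reals all_analysis.
From mathcomp Require Import ring lra zify.

Set Implicit Arguments.
Unset Strict Implicit.
Unset Printing Implicit Defensive.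

Import Order.TTheory GRing.Theory Num.Theory.
Import numFieldNormedType.Exports.

Local Open Scope classical_set_scope.
Local Open Scope ring_scope.

(* If [u] and [v] are uniformly close control sequences, the orbit of a point
   [x] of [Q(u)] is a pseudo-orbit for [v].  In charts along that orbit, with
   finitely many charts covering [Q], the time-dependent system given by [v] is
   a small Lipschitz perturbation of the linearization along the orbit of
   [(u, x)].  Hyperbolicity gives that linearization a Green function with
   exponential decay, with constants independent of [(u, x)], so the pseudo-orbit
   is shadowed by an orbit of [v] (fixed point on finite time windows, then
   compactness) and this shadowing orbit is unique.  By isolation it stays in
   the lift of [Q], so shadowing defines maps between [Q(u)] and [Q(v)]; they are
   mutually inverse by uniqueness, and continuous since their graphs are closed.
   As [U] is compact and connected, any two control sequences are joined by a
   finite chain of uniformly close ones. *)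

(** * Green functions of linear difference equations *)

(** Uniformity is the obstacle that shapes the proof. The hyperbolic estimates concern only vectors
    inside the two subbundles, while a Green function needs bounded projections; that bound is
    extracted from the estimates themselves and from a bound on one step of the linearization, which
    compactness supplies. The splitting lives in the frames [chart_at], which may jump from point to
    point, so it is carried into the finitely many charts at the cost of a constant comparing norms.

    The shadowing radius must not depend on the length of the window: the Green operator is bounded
    in the sup norm by [C * (2 / (1 - l))] for every length. On a window time is a natural number,
    and shifting the control places the window anywhere in the integers.

    Control sequences must be close at all times at once, which closeness in their product topology
    does not give. A chain therefore has to move all coordinates of a sequence in a common number of
    steps. *)

Lemma sum_exp_dist_le (R : realType) (l : R) (t N : nat) : 0 < l < 1 ->
  \sum_(s < N) l ^+ ((t - s.+1) + (s.+1 - t)) <= 2 / (1 - l).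
Proof.
move=> /andP[l0 l1]; have l1' : 0 < 1 - l by lra.
have X0 k : 0 <= l ^+ k by apply: exprn_ge0; lra.
(* The bound is shaped for induction on [N]: [l ^+ (t - N)] dominates the geometric sum before the
   diagonal, and [1 - l ^+ (N - t)] the one after it. One of the two truncated exponents is always
   0. *)
suff H : (1 - l) * \sum_(s < N) l ^+ ((t - s.+1) + (s.+1 - t))
    <= l ^+ (t - N) + 1 - l ^+ (N - t).
  rewrite ler_pdivlMr// mulrC (le_trans H)//.
  have := X0 (N - t)%N; have : l ^+ (t - N) <= 1 by apply: exprn_ile1; lra.
  lra.
elim: N => [|N IH].
  rewrite big_ord0 mulr0 subn0 sub0n expr0; have := X0 t; lra.
rewrite big_ord_recr /= mulrDr.
apply: (le_trans (lerD IH (lexx _))).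
have [Nt|tN] := ltnP N t.
  have -> : (N.+1 - t = 0)%N by lia.
  have -> : (N - t = 0)%N by lia.
  have -> : (t - N = (t - N.+1).+1)%N by lia.
  rewrite addn0 !expr0 exprS; lra.
have -> : (t - N.+1 = 0)%N by lia.
have -> : (t - N = 0)%N by lia.
have -> : (N.+1 - t = (N - t).+1)%N by lia.
rewrite add0n !expr0 exprS.
have := mulr_ge0 (X0 (N - t)%N) (sqr_ge0 (1 - l)).
rewrite expr2; nra.
Qed.

(** Lets matrices be seen as a complete normed module, the setting of [banach_fixed_point]. *)
HB.instance Definition _ (R : realType) m n := Complete.on 'M[R]_(m, n).

Lemma mx_norm_le (R : realType) m n (X : 'M[R]_(m, n)) (r : R) : 0 <= r ->
  (`|X| <= r) <-> (forall i j, `|X i j| <= r).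
Proof.
move=> r0; rewrite [`|X|]mx_normrE; split=> [H i j|H].
  by apply: le_trans H; exact: (le_bigmax _ (fun ij => `|X ij.1 ij.2|) (i, j)).
by apply: bigmax_le => // -[i j] _ /=.
Qed.

Lemma norm_row_le (R : realType) m n (X : 'M[R]_(m, n)) i : `|row i X| <= `|X|.
Proof.
apply/mx_norm_le => // k j; rewrite mxE.
exact: (mx_norm_le X (normr_ge0 _)).1.
Qed.

Section GreenFunction.
Variables (R : realType) (n : nat).
Local Notation V := 'rV[R]_n.
Implicit Types (A : nat -> 'End(V)) (G : nat -> nat -> 'End(V)).

(* [G] is the Green function of [z_(t+1) = A_t z_t]: it inverts the operator
   [z |-> (z_(t+1) - A_t z_t)_t] from the right (second clause) and from the
   left (third clause), and decays exponentially off the diagonal. *)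
Definition green_function (C l : R) A G :=
  [/\ forall t s v, G t.+1 s.+1 v = A t (G t s.+1 v) + (if t == s then v else 0),
      forall t s v, G t s.+1 (A s v) = G t s v - (if t == s then v else 0)
    & forall t s v, `|G t s v| <= C * l ^+ ((t - s) + (s - t)) * `|v|].

Variables (C l : R) (A : nat -> 'End(V)) (G : nat -> nat -> 'End(V)).
Hypotheses (C0 : 0 <= C) (l01 : 0 < l < 1) (GA : green_function C l A G).
Let K := C * (2 / (1 - l)).

Let K0 : 0 <= K.
Proof. by case/andP: l01 => *; apply/mulr_ge0/divr_ge0 => //; lra. Qed.

(** [K] bounds the Green operator in the sup norm, whatever the length [N] of the window. *)
Lemma green_sum_le (N t : nat) (w : nat -> V) (e : R) :
  0 <= e -> (forall s, (s < N)%N -> `|w s| <= e) ->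
  `|\sum_(s < N) G t s.+1 (w s)| <= K * e.
Proof.
move=> e0 we; case: GA => _ _ GA3.
apply: (le_trans (ler_norm_sum _ _ _)).
have -> : K * e = C * e * (2 / (1 - l)) by rewrite /K; ring.
apply: le_trans (ler_wpM2l (mulr_ge0 C0 e0) (sum_exp_dist_le t N l01)).
rewrite mulr_sumr; apply: ler_sum => s _.
apply: (le_trans (GA3 _ _ _)).
rewrite [leRHS]mulrAC; apply: ler_wpM2l; last exact/we.
by apply/mulr_ge0/exprn_ge0 => //; case/andP: l01 => *; lra.
Qed.

Lemma green_sum_rec (N t : nat) (w : nat -> V) : (t < N)%N ->
  \sum_(s < N) G t.+1 s.+1 (w s) = A t (\sum_(s < N) G t s.+1 (w s)) + w t.
Proof.
move=> tN; case: GA => GA1 _ _.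
rewrite linear_sum /=; under eq_bigr do rewrite GA1.
rewrite big_split /=; congr (_ + _).
rewrite (bigD1 (Ordinal tN)) //= eqxx big1 ?addr0 // => i.
by rewrite -val_eqE /= eq_sym => /negbTE ->.
Qed.

(** Summing the defects against the left-inverse clause recovers [d N] up to two boundary terms.
    Both ends of the window lie at distance [N] from its middle, hence the term [2 * C * l ^+ N]. *)
Lemma green_expansive (N : nat) (d : nat -> V) (D eta : R) :
  (0 < N)%N -> 0 <= eta -> 0 <= D ->
  (forall t, (t <= N + N)%N -> `|d t| <= D) ->
  (forall t, (t < N + N)%N -> `|d t.+1 - A t (d t)| <= eta * D) ->
  `|d N| <= (K * eta + 2 * C * l ^+ N) * D.
Proof.
move=> N0 eta0 D0 dD dA; have [_ GA2 GA3] := GA.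
have HS := green_sum_le N (mulr_ge0 eta0 D0) dA.
suff E : d N = \sum_(s < N + N) G N s.+1 (d s.+1 - A s (d s))
     - G N (N + N)%N (d (N + N)%N) + G N 0%N (d 0%N).
  rewrite E; apply: (le_trans (ler_normD _ _)).
  have H0 := GA3 N 0%N (d 0%N); have H1 := GA3 N (N + N)%N (d (N + N)%N).
  rewrite subn0 sub0n addn0 in H0.
  have E1 : (N - (N + N) + (N + N - N) = N)%N by lia.
  rewrite E1 in H1.
  have L0 : 0 <= C * l ^+ N.
    by apply/mulr_ge0/exprn_ge0 => //; case/andP: l01 => *; lra.
  have H2 := ler_wpM2l L0 (dD 0%N (leq0n _)).
  have H3 := ler_wpM2l L0 (dD (N + N)%N (leqnn _)).
  have := ler_normB (\sum_(s < N + N) G N s.+1 (d s.+1 - A s (d s)))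
    (G N (N + N)%N (d (N + N)%N)).
  lra.
(* The partial sums telescope, and the unit jump of [G] on the diagonal adds [d N] once [k] passes
   [N]. *)
suff E k : \sum_(s < k) G N s.+1 (d s.+1 - A s (d s)) =
    G N k (d k) - G N 0%N (d 0%N) + (if (N < k)%N then d N else 0).
  rewrite E ifT; last by lia.
  set a := G N _ (d (N + N)%N); set b := G N 0%N _.
  by apply/rowP => i; rewrite !mxE; ring.
elim: k => [|k IH]; first by rewrite big_ord0 subrr add0r.
rewrite big_ord_recr /= IH linearB /= GA2 ltnS [(N <= k)%N]leq_eqVlt.
set b := G N k.+1 _; set c := G N 0%N _.
case: eqVneq => [<-|_] /=; last by set a := G N k _;
  apply/rowP => i; rewrite !mxE; ring.
by rewrite ltnn; set a := G N N _; apply/rowP => i; rewrite !mxE; ring.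
Qed.

(* The orbit segment is a fixed point of
   [z |-> (\sum_s G t s.+1 (h s (z s)))_t], a contraction of the ball of
   radius [r] in the space of sequences of length [N]. *)
Lemma green_shadowing (N : nat) (h : nat -> V -> V) (r e eta : R) :
  0 < r -> 0 <= e -> 0 <= eta ->
  (forall t, `|h t 0| <= e) ->
  (forall t z z', `|z| <= r -> `|z'| <= r ->
     `|h t z - h t z'| <= eta * `|z - z'|) ->
  K * eta <= 2^-1 -> K * e <= r / 2 ->
  exists z : nat -> V, (forall t, `|z t| <= r) /\
    (forall t, (t < N)%N -> z t.+1 = A t (z t) + h t (z t)).
Proof.
move=> r0 e0 eta0 h0 hl Keta Ke.
(* A sequence of length [N] is stored as the rows of a matrix, whose norm is the sup norm. [v X s]
   reads row [s], with default 0 outside the window. *)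
pose v (X : 'M[R]_(N, n)) (s : nat) : V :=
  if insub s is Some i then row (i : 'I_N) X else 0.
pose T t (X : 'M[R]_(N, n)) : V := \sum_(s < N) G t s.+1 (h s (v X s)).
have vB X Y s : v (X - Y) s = v X s - v Y s.
  by rewrite /v; case: insub => [i|]; rewrite ?linearB ?subrr.
have v_le X s : `|v X s| <= `|X|.
  by rewrite /v; case: insub => [i|]; [exact: norm_row_le | rewrite normr0].
have vr X s : `|X| <= r -> `|v X s| <= r by apply: le_trans.
have hr s z : `|z| <= r -> `|h s z| <= e + eta * r.
  move=> zr; rewrite -[h s z](subrK (h s 0)) addrC.
  apply: (le_trans (ler_normD _ _)); apply: lerD => //.
  have r0' : `|0 : V| <= r by rewrite normr0 ltW.
  by apply: (le_trans (hl _ _ _ zr r0')); rewrite subr0; apply: ler_wpM2l.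
(* [K * e] and [K * (eta * r)] each take at most half of the radius. *)
have Tr t X : `|X| <= r -> `|T t X| <= r.
  move=> Xr; apply: (le_trans (@green_sum_le N t (fun s => h s (v X s))
    (e + eta * r) _ _)).
  - by apply: addr_ge0 => //; apply: mulr_ge0 => //; exact: ltW.
  - by move=> s sN; exact/hr/vr.
  - nra.
have TL t X Y : `|X| <= r -> `|Y| <= r -> `|T t X - T t Y| <= 2^-1 * `|X - Y|.
  move=> Xr Yr; rewrite -sumrB; under eq_bigr do rewrite -linearB.
  apply: (le_trans (@green_sum_le N t (fun s => h s (v X s) - h s (v Y s))
    (eta * `|X - Y|) _ _)); first exact: mulr_ge0.
    move=> s sN; apply: (le_trans (hl _ _ _ (vr _ _ Xr) (vr _ _ Yr))).
    by apply: ler_wpM2l => //; rewrite -vB.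
  by rewrite mulrA; apply: ler_wpM2r.
pose F (X : 'M[R]_(N, n)) : 'M[R]_(N, n) := \matrix_(s < N) T s X.
pose B : set 'M[R]_(N, n) := [set X | `|X| <= r].
have FB : set_fun B B F.
  move=> X XB; apply/mx_norm_le => [|i j]; first exact: ltW.
  rewrite mxE.
  exact: (mx_norm_le _ (ltW r0)).1 (Tr i X XB) ord0 j.
pose F' : {fun B >-> B} := HB.pack F (isFun.Build _ _ B B F FB).
have [||| X XB XF] := @banach_fixed_point R ('M[R]_(N, n)) B F'.
- exists (2^-1)%:nng; split; first by rewrite /=; lra.
  move=> [X Y] [/= XB YB]; apply/mx_norm_le => [|i j]; first exact: mulr_ge0.
  have := (mx_norm_le _ _).1 (TL i X Y XB YB) ord0 j.
  by rewrite !mxE; apply; exact: mulr_ge0.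
- apply: (@closed_comp _ _ (fun X : 'M[R]_(N, n) => `|X|) [set x | x <= r]).
    by move=> ? _; exact: norm_continuous.
  exact: closed_le.
- by exists 0; rewrite /B /= normr0 ltW.
(* [T t X] makes sense for every [t], so this witness also covers the endpoint [t = N], which is not
   a row of [X]. *)
exists (T ^~ X); split=> [t|t tN]; first exact: Tr.
rewrite /T (@green_sum_rec N t (fun s => h s (v X s))) //.
have XE (i : 'I_N) j : X i j = T i X ord0 j by rewrite {1}XF /= mxE.
by congr (_ + h t _); rewrite /v insubT; apply/rowP => j; rewrite mxE XE.
Qed.

End GreenFunction.

(** * Differential calculus in coordinates *)

(** Chart representatives of composites agree only near the base point, since charts are total
    functions with no meaning outside their domains. *)
Lemma near_eq_diff (R : numFieldType) (V W : normedModType R) (f g : V -> W)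
    (x : V) : (\near x, f x = g x) -> differentiable f x ->
  differentiable g x /\ 'd g x = 'd f x :> (V -> W).
Proof.
move=> fg df; have [dfc fE] := (diff_locallyP _ _).1 df.
have gE : g \o shift x = cst (g x) + 'd f x +o_ 0 id.
  apply/eqaddoP => e e0; move/eqaddoP : fE => /(_ e e0) fe.
  have fg' : \forall h \near (0 : V), f (h + x) = g (h + x).
    by move: fg; rewrite (near_shift 0 x) /=; apply: filterS => h;
      rewrite /= subr0.
  apply: filterS2 fg' fe => h E.
  by rewrite -(nbhs_singleton fg) /= !fctE /= E.
have dE := diff_unique dfc gE.
by split=> //; apply/diff_locallyP; rewrite dE.
Qed.

(** The derivative of the system is assumed continuous on each fixed vector; finitely many such
    estimates, on the basis, give an operator bound at the price of the factor [m]. *)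
Lemma linear_norm_diff_le (R : realType) m n (L L' : {linear 'rV[R]_m -> 'rV[R]_n})
    (b : R) : (forall i, `|L (delta_mx 0 i) - L' (delta_mx 0 i)| <= b) ->
  forall v, `|L v - L' v| <= m%:R * b * `|v|.
Proof.
move=> Lb v.
have E (F : {linear 'rV[R]_m -> 'rV[R]_n}) :
    F v = \sum_(i < m) v 0 i *: F (delta_mx 0 i).
  rewrite [in LHS](row_sum_delta v) linear_sum.
  by apply: eq_bigr => i _; rewrite linearZ.
rewrite !E -sumrB.
apply: (le_trans (ler_norm_sum _ _ _)).
have -> : m%:R * b * `|v| = \sum_(i < m) (`|v| * b).
  by rewrite sumr_const card_ord -[RHS]mulr_natl -mulrA [b * _]mulrC.
apply: ler_sum => i _; rewrite -scalerBr normrZ.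
by apply: ler_pM => //; exact: (mx_norm_le v (normr_ge0 v)).1.
Qed.

Lemma linear_norm_le (R : realType) m n (L : {linear 'rV[R]_m -> 'rV[R]_n})
    (b : R) : (forall i, `|L (delta_mx 0 i)| <= b) ->
  forall v, `|L v| <= m%:R * b * `|v|.
Proof.
move=> Lb v; have := @linear_norm_diff_le R m n L \0%R b.
by rewrite /= => /(_ _ v); rewrite subr0; apply => i; rewrite /= subr0.
Qed.

(** The norm is the largest absolute value of a coordinate, so the scalar mean value theorem for
    each coordinate of [f - L] along the segment is enough, even though the intermediate point
    depends on the coordinate. *)
Lemma mean_value_ball (R : realType) m n (f : 'rV[R]_m -> 'rV[R]_n)
    (L : {linear 'rV[R]_m -> 'rV[R]_n}) p (r eta : R) :
  (forall z, ball p r z -> differentiable f z) ->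
  (forall z v, ball p r z -> `|'d f z v - L v| <= eta * `|v|) ->
  forall z z', ball p r z -> ball p r z' ->
    `|f z - f z' - L (z - z')| <= eta * `|z - z'|.
Proof.
move=> df dfL z z' zp z'p; set w := z - z'.
have segp (s : R) : s \in `[0, 1]%R -> ball p r (z' + s *: w).
  rewrite in_itv /= => /andP[s0 s1].
  move: zp z'p; rewrite -!ball_normE /ball_ /= => zp z'p.
  have -> : p - (z' + s *: w) = s *: (p - z) + (1 - s) *: (p - z').
    by rewrite /w; apply/rowP => i; rewrite !mxE; ring.
  apply: (le_lt_trans (ler_normD _ _)); rewrite !normrZ.
  rewrite (ger0_norm s0) ger0_norm; last by lra.
  have [->|sn0] := eqVneq s 0; first by lra.
  have sp : 0 < s by rewrite lt_def sn0.
  have := mulr_gt0 sp (_ : 0 < r - `|p - z|); rewrite subr_gt0 => /(_ zp).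
  have := mulr_ge0 (_ : 0 <= 1 - s) (_ : 0 <= r - `|p - z'|).
  by rewrite !subr_ge0 => /(_ s1 (ltW z'p)); lra.
have eta0 : 0 <= eta * `|w|.
  by apply: le_trans (dfL z w zp).
apply/mx_norm_le => // i j; rewrite (ord1 i) {i}.
pose g (s : R) := z' + s *: w.
pose phi (s : R) : R := (f (g s)) ord0 j - s * (L w) ord0 j.
have dg (s : R) : is_diff s g (fun h => h *: w).
  apply: is_diff_eq (is_diffD (is_diff_cst z' s) (is_diff_scalel s w)) _.
  by apply/funext => h; rewrite fctE add0r.
have dphi (s : R) : s \in `[0, 1]%R ->
    is_derive s (1 : R) phi ((('d f (g s) w) - L w) ord0 j).
  move=> s01.
  have dfs : differentiable f (g s) by exact/df/segp.
  have dfg : derivable (f \o g) s 1 by apply: diff_derivable; apply: differentiable_comp.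
  have dc : is_derive s (1 : R) (fun x => (f \o g) x ord0 j)
      (('d f (g s) w) ord0 j).
    split; first exact: (derivable_mxP _ _ _).1 dfg ord0 j.
    have := derive_mx dfg; rewrite deriveE; last exact/differentiable_comp.
    rewrite diff_comp // /= => /(congr1 (fun X : 'rV[R]_n => X ord0 j)).
    by rewrite !mxE diff_val scale1r => <-.
  have dl : is_derive s (1 : R) (fun x : R => x * (L w) ord0 j) ((L w) ord0 j).
    rewrite (_ : (fun x => _) = (L w) ord0 j \*: (id : R -> R)); last first.
      by apply/funext => x; rewrite mulrC.
    apply: is_derive_eq (is_deriveZ _ (is_derive_id s 1)) _.
    by rewrite /GRing.scale /= mulr1.
  rewrite (_ : phi = (fun x => (f \o g) x ord0 j) - (fun x => x * (L w) ord0 j)) //.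
  by apply: is_derive_eq (is_deriveB dc dl) _; rewrite !mxE.
pose psi (s : R) : R := ('d f (g s) w - L w) ord0 j.
have dphi_oo (s : R) : s \in `]0, 1[%R -> is_derive s (1 : R) phi (psi s).
  by move=> s01; apply: dphi; exact: subset_itv_oo_cc.
have phi_cont : {within `[0, 1], continuous phi}.
  apply: derivable_within_continuous => s s01.
  exact: (@ex_derive _ _ _ _ _ _ _ (dphi s s01)).
have [c c01] := MVT_segment (@ler01 R) dphi_oo phi_cont.
rewrite subr0 mulr1 /phi /g scale1r scale0r addr0 mul1r mul0r subr0 subrKC => E.
have -> : (f z - f z' - L w) ord0 j = ('d f (g c) w - L w) ord0 j.
  by rewrite -[RHS]/(psi c) -E !mxE; ring.
exact/(mx_norm_le _ eta0).1/dfL/segp.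
Qed.

(** The centre varies together with the radius: this is the form from which a compactness argument
    extracts one radius for all centres. *)
Lemma near_ball_swell (R : realType) (X : pseudoMetricType R) (p0 : X)
    (P : set X) : (\near p0, P p0) ->
  \forall p \near p0 & r \near 0^'+, forall q, ball p r q -> P q.
Proof.
move=> /nbhs_ballP[e /= e0 eP].
exists (ball p0 (e / 2), [set r : R | r < e / 2]) => /=.
  split; first by apply: nbhsx_ballx; exact: divr_gt0.
  by apply: nbhs_right_lt; exact: divr_gt0.
move=> [p r] [/= pe re] q prq; apply: eP; rewrite [e]splitr.
by apply: ball_triangle pe _; exact: le_ball (ltW re) _ prq.
Qed.

(** * From exponential dichotomies to Green functions *)

Section Dichotomy.
Variables (R : realType) (n : nat).
Local Notation V := 'rV[R]_n.

(* [E t s] is the evolution of [z_(t+1) = A_t z_t] from time [s] to time [t],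
   backward evolution included. *)
Definition exponential_dichotomy (C l : R) (A : nat -> 'End(V))
    (E : nat -> nat -> 'End(V)) (Pm Pp : nat -> 'End(V)) :=
  [/\ [/\ forall t v, E t t v = v,
          forall r t s v, E r t (E t s v) = E r s v
        & forall t v, E t.+1 t v = A t v],
      [/\ forall t v, Pm t v + Pp t v = v,
          forall t v, Pp t (Pp t v) = Pp t v,
          forall t s v, E t s (Pm s v) = Pm t (E t s v)
        & forall t s v, E t s (Pp s v) = Pp t (E t s v)],
      forall t s v, (s <= t)%N ->
        `|E t s (Pm s v)| <= C * l ^+ (t - s) * `|Pm s v|
    & forall t s v, (t <= s)%N ->
        `|E t s (Pp s v)| <= C * l ^+ (s - t) * `|Pp s v|].

(** The dichotomy controls [E] only on the ranges of the projections. The projections themselves are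
    bounded through the one-step bound [B] and a time [T] after which the decay factor is at most
    1/2, so [C'] depends on [C], [l] and [B] alone. *)
Lemma dichotomy_green (C l B : R) : 0 <= C -> 0 <= B -> 0 < l < 1 ->
  exists2 C' : R, 0 <= C' &
    forall (A : nat -> 'End(V)) (E : nat -> nat -> 'End(V))
      (Pm Pp : nat -> 'End(V)),
    (forall t v, `|A t v| <= B * `|v|) ->
    exponential_dichotomy C l A E Pm Pp ->
    exists G, green_function C' l A G.
Proof.
move=> C0 B0 l01; have [l0 l1] := andP l01.
have [T qT] : exists T, C * l ^+ T <= 2^-1.
  have /cvgrPdist_lt /(_ (2^-1 / (C + 1))) : l ^+ k @[k --> \oo] --> (0 : R).
    by apply: cvg_expr; rewrite ger0_norm // ltW.
  move=> /(_ _)[|T _ /(_ T (leqnn _))]; first by apply: divr_gt0; lra.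
  rewrite sub0r normrN ger0_norm; last exact/exprn_ge0/ltW.
  rewrite ltr_pdivlMr; last by lra.
  have := exprn_ge0 T (ltW l0); exists T; nra.
have q0 : 0 <= C * l ^+ T by apply/mulr_ge0/exprn_ge0 => //; exact: ltW.
have BT0 : 0 <= B ^+ T by apply: exprn_ge0.
exists (C * (B ^+ T + 2)); first by apply: mulr_ge0 => //; lra.
move=> A E Pm Pp AB [[Eid EE EA] [PE PpP EPm EPp] Em Ep].
have EB s k v : `|E (s + k)%N s v| <= B ^+ k * `|v|.
  elim: k => [|k IH]; first by rewrite addn0 Eid expr0 mul1r.
  rewrite addnS -(EE _ (s + k)%N) EA exprS -mulrA; apply: (le_trans (AB _ _)).
  exact: ler_wpM2l.
have Pm_le s v : `|Pm s v| <= `|v| + `|Pp s v|.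
  by rewrite -{2}(PE s v) -{1}[Pm s v](addrK (Pp s v)) ler_normB.
(* [Pp s v] is recovered by evolving it [T] steps forward and back; forward it
   differs from the evolution of [v] by the contracted term [Pm s v], and the
   way back contracts. *)
have Pp_bound s v : `|Pp s v| <= (B ^+ T + 1) * `|v|.
  have sT : (s <= s + T)%N by rewrite leq_addr.
  have h1 := Ep s (s + T)%N (E (s + T)%N s (Pp s v)) sT.
  rewrite -EPp PpP EE Eid addKn in h1.
  have h2 := Em (s + T)%N s v sT; rewrite addKn in h2.
  have h3 : `|E (s + T)%N s (Pp s v)| <= B ^+ T * `|v| + C * l ^+ T * `|Pm s v|.
    have -> : E (s + T)%N s (Pp s v) = E (s + T)%N s v - E (s + T)%N s (Pm s v).
      by rewrite -linearB -{2}(PE s v) addrC addKr.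
    by apply: (le_trans (ler_normB _ _)); apply: lerD (EB _ _ _) h2.
  have h4 := Pm_le s v.
  move: h1 h3 h4 qT q0 BT0; set q := C * l ^+ T; set a := `|Pp s v|.
  set b := `|Pm s v|; set e := `|E _ _ _|; set vv := `|v| => h1 h3 h4 qT q0 BT0.
  have a0 : 0 <= a := normr_ge0 _; have v0 : 0 <= vv := normr_ge0 _.
  have h5 : q * e <= q * (B ^+ T * vv + q * (vv + a)).
    by apply: ler_wpM2l => //; apply: (le_trans h3); rewrite lerD2l ler_wpM2l.
  have h6 : 0 <= B ^+ T * vv by apply: mulr_ge0.
  have h7 : q * (B ^+ T * vv) <= 2^-1 * (B ^+ T * vv) by apply: ler_wpM2r.
  have h8 : q * (q * (vv + a)) <= 2^-1 * (2^-1 * (vv + a)).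
    by apply: ler_pM => //; [apply: mulr_ge0; lra|apply: ler_wpM2r; lra].
  lra.
have Pm_bound s v : `|Pm s v| <= (B ^+ T + 2) * `|v|.
  by apply: (le_trans (Pm_le s v)); have := Pp_bound s v; lra.
have Pp_bound' s v : `|Pp s v| <= (B ^+ T + 2) * `|v|.
  by apply: (le_trans (Pp_bound s v)); apply: ler_wpM2r => //; lra.
(* Forward along the contracted part, minus backward along the expanded part: the jump across the
   diagonal is [Pm + Pp], the identity. *)
exists (fun t s => if (s <= t)%N then (E t s \o Pm s)%VF else - (E t s \o Pp s)%VF).
split=> [t s v|t s v|t s v].
- have AE q r w : A q (E q r w) = E q.+1 r w by rewrite -EA EE.
  rewrite ltnS; have [st|ts|<-] := ltngtP s t.
  + by rewrite addr0 !comp_lfunE AE.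
  + by rewrite addr0 !opp_lfunE !comp_lfunE linearN /= AE.
  + by rewrite opp_lfunE !comp_lfunE linearN /= AE !Eid -{3}(PE s.+1 v) addrC addrK.
- have EA' r w : E r s.+1 (A s w) = E r s w by rewrite -EA EE.
  have [st|ts|<-] := ltngtP s t.
  + by rewrite subr0 !comp_lfunE -EA -EPm EE.
  + by rewrite subr0 !opp_lfunE !comp_lfunE -EA -EPp EE.
  + rewrite opp_lfunE !comp_lfunE -EA -EPp EE !Eid.
    by rewrite -{3}(PE s v) opprD addNKr.
- rewrite (_ : _ * _ * _ = C * l ^+ (t - s + (s - t)) * ((B ^+ T + 2) * `|v|));
    last by ring.
  have L0 k : 0 <= C * l ^+ k by apply/mulr_ge0/exprn_ge0 => //; exact: ltW.
  case: leqP => [st|/ltnW ts].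
    rewrite comp_lfunE (eqP st) addn0; apply: (le_trans (Em t s v st)).
    exact: ler_wpM2l.
  rewrite opp_lfunE comp_lfunE normrN (eqP ts) add0n.
  by apply: (le_trans (Ep t s v ts)); apply: ler_wpM2l.
Qed.

End Dichotomy.

(** * Differentials in charts and the transition map *)

Section ChartDifferential.
Variables (R : realType) (n : nat) (M : topologicalType).
Variable A : smooth_manifold R n M.
Implicit Types (c : chart R n M) (F G : M -> M).

Lemma cinv_range c z : (cmap c @` cdom c) z ->
  cdom c (cinv c z) /\ cmap c (cinv c z) = z.
Proof. by case=> x cx <-; rewrite cmapK. Qed.

Lemma near_chart_range c x : cdom c x ->
  \forall z \near cmap c x, (cmap c @` cdom c) z.
Proof.
by move=> cx; apply: open_nbhs_nbhs; split; [exact: crange_open | exists x].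
Qed.

Lemma near_cinv c x (P : set M) : cdom c x -> (\near x, P x) ->
  \forall z \near cmap c x, P (cinv c z).
Proof.
move=> cx xP; apply: (cinv_continuous cx).
by rewrite cmapK.
Qed.

Definition chart_diff c c' F x : {linear 'rV[R]_n -> 'rV[R]_n} :=
  'd (cmap c' \o F \o cinv c) (cmap c x).

(** Continuity keeps [F y] in the target chart for [y] near [x], as the chain rule requires;
    differentiable representatives alone do not ensure it. *)
Definition mdifferentiable F x := {for x, continuous F} /\
  forall c c', charts A c -> charts A c' -> cdom c x -> cdom c' (F x) ->
    differentiable (cmap c' \o F \o cinv c) (cmap c x).

Lemma mdifferentiable_id x : mdifferentiable id x.
Proof.
split=> // c c' Ac Ac' cx c'x.
have [H _] := charts_compat Ac Ac' 1; apply: H; exists x => //; by split.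
Qed.

Lemma C1_mdifferentiable F x : C1_map A F -> mdifferentiable F x.
Proof.
move=> [Fc F1]; split; first exact: Fc.
move=> c c' Ac Ac' cx c'x; have [H _] := F1 _ _ Ac Ac'.
by apply: H; exists x.
Qed.

Lemma chart_diff_id c x : cdom c x -> chart_diff c c id x =1 id.
Proof.
move=> cx v; rewrite /chart_diff.
have did : differentiable (@id 'rV[R]_n) (cmap c x) by [].
have e : \forall z \near cmap c x, id z = (cmap c \o id \o cinv c) z.
  by apply: filterS (near_chart_range cx) => z /cinv_range[_ /= ->].
by rewrite (near_eq_diff e did).2 diff_val.
Qed.

Lemma chain_near F G x c c' c'' : mdifferentiable F x ->
  cdom c x -> cdom c' (F x) ->
  \forall z \near cmap c x, ((cmap c'' \o G \o cinv c') \o (cmap c' \o F \o cinv c)) z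
     = (cmap c'' \o (G \o F) \o cinv c) z.
Proof.
move=> [Fc _] cx c'x.
have : \forall y \near x, cdom c' (F y).
  by apply: Fc; apply: open_nbhs_nbhs; split => //; exact: cdom_open.
by move=> /(near_cinv cx); apply: filterS => z /= c'z; rewrite cmapK.
Qed.

Lemma mdifferentiable_comp F G x : mdifferentiable F x ->
  mdifferentiable G (F x) -> mdifferentiable (G \o F) x.
Proof.
move=> dF dG; split; first by apply: continuous_comp; [exact: dF.1|exact: dG.1].
move=> c c'' Ac Ac'' cx c''x.
have c'x := chart_at_dom A (F x); have Ac' := chart_at_charts A (F x).
apply: (near_eq_diff (chain_near G c'' dF cx c'x) _).1.
apply: differentiable_comp; first exact: dF.2.
by rewrite /= cmapK //; apply: dG.2.
Qed.

Lemma chart_diff_comp F G x c c' c'' :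
  charts A c -> charts A c' -> charts A c'' ->
  mdifferentiable F x -> mdifferentiable G (F x) ->
  cdom c x -> cdom c' (F x) -> cdom c'' (G (F x)) ->
  forall v, chart_diff c c'' (G \o F) x v =
    chart_diff c' c'' G (F x) (chart_diff c c' F x v).
Proof.
move=> Ac Ac' Ac'' dF dG cx c'x c''x v; rewrite /chart_diff.
have d1 := dF.2 _ _ Ac Ac' cx c'x.
have d2 := dG.2 _ _ Ac' Ac'' c'x c''x.
have e : (cmap c' \o F \o cinv c) (cmap c x) = cmap c' (F x) by rewrite /= cmapK.
have d2' : differentiable (cmap c'' \o G \o cinv c')
    ((cmap c' \o F \o cinv c) (cmap c x)) by rewrite e.
have [_ E1] := near_eq_diff (chain_near G c'' dF cx c'x)
  (differentiable_comp d1 d2').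
have E2 := diff_comp d1 d2'.
rewrite -e; exact: (etrans (congr1 (fun f => f v) E1) (congr1 (fun f => f v) E2)).
Qed.

Lemma mdiffE F x v :
  mdiff A F x v = chart_diff (chart_at A x) (chart_at A (F x)) F x v.
Proof. by rewrite /mdiff lfunE. Qed.

End ChartDifferential.

Section ControlFlowTheory.
Variables (R : realType) (n : nat) (M : topologicalType).
Variables (A : smooth_manifold R n M) (U : topologicalType).
Variable S : control_system A U.
Implicit Types (u : control_seq U) (x : M) (t s : int).

Lemma phi0 x u : phi S 0 x u = x. Proof. by []. Qed.

Lemma phiS t x u : phi S (t + 1) x u = rhs S (phi S t x u) (u t).
Proof.
case: t => [t|t]; first by rewrite -PoszD addn1.
rewrite NegzE; case: t => [|t]; first by rewrite addNr /= rhs_invK.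
rewrite (_ : - t.+2%:Z + 1 = Negz t); last by rewrite NegzE; lia.
by rewrite -NegzE [in RHS]/= NegzE rhs_invK.
Qed.

Lemma phi_pred t x u : phi S (t - 1) x u = rhs_inv S (phi S t x u) (u (t - 1)).
Proof. by rewrite -{2}[t](subrK 1) phiS rhsK. Qed.

Lemma phiD t s x u :
  phi S (t + s) x u = phi S t (phi S s x u) (shift_seq s u).
Proof.
elim/int_ind: t => [|t IH|t IH]; first by rewrite add0r.
  by rewrite intS (addrC 1) addrAC phiS IH -phiS.
rewrite intS opprD (addrC (-1)) addrAC !phi_pred IH.
by rewrite /shift_seq addrAC.
Qed.

Lemma shift_seqD t s u : shift_seq t (shift_seq s u) = shift_seq (t + s) u.
Proof. by apply/funext => k; rewrite /shift_seq addrA. Qed.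

Lemma phiE1 t u : phi S 1 ^~ (shift_seq t u) = rhs S ^~ (u t).
Proof. by apply/funext => x; rewrite /= /shift_seq add0r. Qed.

Lemma lift_flow (Q : set M) u x s : all_time_lift S Q (u, x) ->
  all_time_lift S Q (shift_seq s u, phi S s x u).
Proof. by move=> H t; rewrite /= -phiD; exact: H. Qed.

Lemma phi_mdifferentiable t u x : mdifferentiable A (phi S t ^~ u) x.
Proof.
have fwd k : mdifferentiable A (phi_fwd S k ^~ u) x.
  elim: k => [|k IH]; first exact: mdifferentiable_id.
  exact: (mdifferentiable_comp IH (C1_mdifferentiable _ (rhs_C1 S (u k)))).
have bwd k : mdifferentiable A (phi_bwd S k ^~ u) x.
  elim: k => [|k IH]; first exact: mdifferentiable_id.
  exact: (mdifferentiable_comp IH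
    (C1_mdifferentiable _ (rhs_inv_C1 S (u (- k.+1%:Z))))).
by case: t => t; [exact: fwd|exact: bwd].
Qed.

Lemma phi_continuous t u : continuous (phi S t ^~ u).
Proof. by move=> x; exact: (phi_mdifferentiable t u x).1. Qed.

End ControlFlowTheory.

(** * Uniform estimates in finitely many charts *)

Lemma compact_nbhs_cover (T : topologicalType) (Q : set T) (K : T -> set T) :
  compact Q -> (forall x, Q x -> nbhs x (K x)) ->
  exists s : seq T, forall x, Q x -> exists2 q, q \in s & K q x.
Proof.
move=> /compact_near_coveringP cQ nK.
(* Finite lists directed by inclusion: a property near this filter holds for all large enough lists,
   so compactness yields a single list serving every point. *)
pose F : set_system (seq T) := [set E : set (seq T) | exists s0 : seq T,
  forall s : seq T, {subset s0 <= s} -> E s].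
have FF : Filter F.
  split; first by exists [::].
    move=> P P' [s sP] [s' sP']; exists (s ++ s') => t st.
    split; [apply: sP|apply: sP'] => x xs; apply: st; rewrite mem_cat xs //.
    by rewrite orbT.
  by move=> P P' PP' [s sP]; exists s => t /sP /PP'.
have [|s /(_ s (fun _ => id)) sQ] :=
    cQ _ F (fun s x => exists2 q, q \in s & K q x) FF.
  move=> x Qx; exists (K x, [set s : seq T | x \in s]) => /=.
    split; first exact: nK.
    by exists [:: x] => s; apply; rewrite mem_head.
  by move=> [y s] [/= Ky xs]; exists x.
by exists s.
Qed.

Section FiniteCharts.
Variables (R : realType) (n : nat) (M : topologicalType).
Variable A : smooth_manifold R n M.

Lemma compact_chart_neighborhood (q : M) : exists K : set M,
  [/\ compact K, nbhs q K & K `<=` cdom (chart_at A q)].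
Proof.
set c := chart_at A q; have cq : cdom c q := chart_at_dom A q.
have /nbhs_ballP[e /= e0 eP] := near_chart_range cq.
have e2 : 0 < e / 2 by apply: divr_gt0.
pose B : set 'rV[R]_n := closed_ball (cmap c q) (e / 2).
have Brange : B `<=` cmap c @` cdom c.
  move=> z; rewrite /B closed_ballE // /closed_ball_ /= => zB; apply: eP.
  by rewrite -ball_normE /ball_ /=; apply: (le_lt_trans zB); lra.
exists (cinv c @` B); split.
- apply: continuous_compact.
    apply: continuous_in_subspaceT => z /set_mem /Brange[x cx <-].
    exact: cinv_continuous.
  apply: bounded_closed_compact; last exact: closed_ball_closed.
  rewrite /B closed_ballE //.
  exists (`|cmap c q| + e / 2); split; first exact: num_real.
  move=> y yM z /= zB; apply/(le_trans _ (ltW yM)).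
  rewrite -[z](subrK (cmap c q)) addrC; apply: (le_trans (ler_normD _ _)).
  by rewrite lerD2l distrC.
- have : \forall x \near q, cdom c x /\ ball (cmap c q) (e / 2) (cmap c x).
    apply: filterI; last by apply: (cmap_continuous cq); exact: nbhsx_ballx.
    by apply: open_nbhs_nbhs; split => //; exact: cdom_open.
  apply: filterS => x [cx xB]; exists (cmap c x); last exact: cmapK.
  exact: subset_closed_ball.
- by move=> _ [z /Brange zr <-]; exact: (cinv_range zr).1.
Qed.

Lemma finite_chart_cover (Q : set M) : compact Q ->
  exists (I : finType) (c : I -> chart R n M) (K : I -> set M),
  [/\ forall i, charts A (c i), forall i, compact (K i),
      forall i, K i `<=` cdom (c i) & forall x, Q x -> exists i, K i x].
Proof.
move=> cQ; have [K KP] := choice compact_chart_neighborhood.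
have [s sQ] : exists s : seq M, forall x, Q x -> exists2 q, q \in s & K q x.
  by apply: compact_nbhs_cover cQ _ => x _; have [] := KP x.
exists (seq_sub s), (fun i => chart_at A (val i)), (fun i => K (val i)); split.
- by move=> i; exact: chart_at_charts.
- by move=> i; have [] := KP (val i).
- by move=> i; have [] := KP (val i).
- by move=> x /sQ[q qs Kq]; exists (SeqSub qs).
Qed.

End FiniteCharts.

Section UniformCharts.
Variables (R : realType) (n : nat) (M : topologicalType).
Variables (A : smooth_manifold R n M) (U : metricType R).
Variable S : control_system A U.
Hypothesis U_compact : compact [set: U].
Variables (I : finType) (c : I -> chart R n M) (K : I -> set M).
Hypotheses (Ac : forall i, charts A (c i)) (Kc : forall i, compact (K i)).
Hypothesis Kdom : forall i, K i `<=` cdom (c i).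

Definition step_map i j (b : U) : 'rV[R]_n -> 'rV[R]_n :=
  cmap (c j) \o rhs S ^~ b \o cinv (c i).

Definition step_close i j (eta : R) (a : U) (y : 'rV[R]_n) (b : U)
    (z : 'rV[R]_n) :=
  [/\ (cmap (c i) @` cdom (c i)) z,
      cdom (c j) (rhs S (cinv (c i) z) b),
      `|step_map i j b z - step_map i j a y| <= eta
    & forall v, `|'d (step_map i j b) z v - 'd (step_map i j a) y v|
        <= eta * `|v|].

Lemma near_step_close i j (eta : R) a x : 0 < eta -> cdom (c i) x ->
  cdom (c j) (rhs S x a) ->
  \forall p \near (a, cmap (c i) x),
    step_close i j eta a (cmap (c i) x) p.1 p.2.
Proof.
move=> eta0 ci cj; pose y := cmap (c i) x.
have fc : {for (a, y), continuous (fun p : U * 'rV[R]_n =>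
    rhs S (cinv (c i) p.2) p.1)}.
  have h : {for (a, y), continuous (fun p : U * 'rV[R]_n => (cinv (c i) p.2, p.1))}.
    apply: cvg_pair; last exact: cvg_fst.
    apply: (@cvg_comp _ _ _ snd (cinv (c i))); first exact: cvg_snd.
    exact: cinv_continuous.
  apply: (@continuous_comp _ _ _ _ (fun q : M * U => rhs S q.1 q.2) _ h).
  exact: rhs_continuous.
have cj' : cdom (c j) (rhs S (cinv (c i) y) a) by rewrite /y cmapK.
(* Passing from basis vectors to all vectors costs a factor [n]; dividing by [n.+1] is also safe in
   dimension 0. *)
have e0 : 0 < eta / n.+1%:R by apply: divr_gt0.
near=> p; split.
- near: p; have := near_chart_range ci.
  by move=> H; apply: (@cvg_snd _ _ (nbhs a) (nbhs y)).
- near: p; apply: fc => /=.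
  by apply: open_nbhs_nbhs; split; [exact: cdom_open|].
- rewrite distrC; near: p.
  have h : {for (a, y), continuous (fun p : U * 'rV[R]_n => step_map i j p.1 p.2)}.
    exact: (@continuous_comp _ _ _ _ (cmap (c j)) _ fc (cmap_continuous cj')).
  by move/cvgrPdist_le : h; exact.
- have H : forall k, `|'d (step_map i j p.1) (p.2) (delta_mx 0 k) -
      'd (step_map i j a) y (delta_mx 0 k)| <= eta / n.+1%:R.
    move=> k; rewrite distrC; move: k; near: p; apply: filter_forall => k.
    have : {for (a, y), continuous (fun p : U * 'rV[R]_n =>
        'd (step_map i j p.1) (p.2) (delta_mx 0 k))}.
      exact: rhs_diff_continuous.
    by move/cvgrPdist_le; exact.
  move=> v; apply: (le_trans (linear_norm_diff_le H v)); apply: ler_wpM2r => //.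
  rewrite mulrCA ger_pMr // ler_pdivrMr // mul1r ler_nat; exact: leqnSn.
Unshelve. all: by end_near. Qed.

(** The pairs whose step can be read from chart [i] to chart [j]; their compactness makes the local
    estimates uniform. *)
Definition transitions i j : set (U * M) :=
  [set p | K i p.2 /\ K j (rhs S p.2 p.1)].

Lemma compact_transitions i j : compact (transitions i j).
Proof.
have Kcl k : closed (K k) by apply: compact_closed (manifold_hausdorff A) _.
apply: (@subclosed_compact _ _ ([set: U] `*` K i)); last 2 first.
- exact: compact_setX.
- by move=> p [Kp _].
apply: closedI; first by apply: closed_comp (Kcl i) => p _; exact: cvg_snd.
apply: closed_comp (Kcl j) => p _.
have h : {for p, continuous (fun p : U * M => (p.2, p.1))}.
  by apply: cvg_pair; [exact: cvg_snd|exact: cvg_fst].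
apply: (@continuous_comp _ _ _ _ (fun q : M * U => rhs S q.1 q.2) _ h).
exact: rhs_continuous.
Qed.

Lemma near_transition i (a : U) (x : M) (P : set (U * 'rV[R]_n)) : K i x ->
  (\forall p \near (a, cmap (c i) x), P p) ->
  \forall p \near (a, x), P (p.1, cmap (c i) p.2).
Proof.
move=> Ki nP.
have h1 : p.1 @[p --> (a, x)] --> nbhs a by exact: cvg_fst.
have h2 : cmap (c i) p.2 @[p --> (a, x)] --> nbhs (cmap (c i) x).
  apply: (@cvg_comp _ _ _ snd (cmap (c i))); first exact: cvg_snd.
  exact/cmap_continuous/Kdom.
exact: (cvg_pair h1 h2 nP).
Qed.

(** Near each transition, the base point and the perturbed one are both compared with the same
    centre, at a cost of [eta / 2] each. *)
Lemma unif_step_close i j (eta : R) : 0 < eta ->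
  \forall r \near 0^'+, forall a x, K i x -> K j (rhs S x a) ->
    forall b z, ball a r b -> ball (cmap (c i) x) r z ->
      step_close i j eta a (cmap (c i) x) b z.
Proof.
move=> eta0; have e0 : 0 < eta / 2 by apply: divr_gt0.
have H : \forall r \near (0 : R)^'+, transitions i j `<=` [set p | forall q,
    ball (p.1, cmap (c i) p.2) r q ->
    step_close i j eta p.1 (cmap (c i) p.2) q.1 q.2].
  move: (@compact_transitions i j) => /compact_near_coveringP; apply.
  move=> [a0 x0] [/= Ki Kj].
  have near0 := near_step_close e0 (Kdom Ki) (Kdom Kj).
  have [[B C] /= [nB nC] BC] := near_ball_swell near0.
  exists ([set p | B (p.1, cmap (c i) p.2)], C `&` [set r | 0 < r]) => /=.
    split; first exact: near_transition.
    by apply: filterI => //; exact: nbhs_right_gt.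
  move=> [[a x] r] [/= Bax [Cr r0]] q axq.
  have [_ _ h1 h2] := BC (_, _) (conj Bax Cr) (a, cmap (c i) x) (ballxx _ r0).
  have [k1 k2 k3 k4] := BC (_, _) (conj Bax Cr) q axq.
  split; [exact: k1|exact: k2| |].
    apply: (le_trans (ler_distD (step_map i j a0 (cmap (c i) x0)) _ _)).
    by rewrite [eta]splitr; apply: lerD; [exact: k3|rewrite distrC; exact: h1].
  move=> v.
  apply: (le_trans (ler_distD ('d (step_map i j a0) (cmap (c i) x0) v) _ _)).
  rewrite [eta]splitr mulrDl; apply: lerD; first exact: k4.
  by rewrite distrC; exact: h2.
by apply: filterS H => r rP a x Ki Kj b z ab xz;
  exact: (rP (a, x) (conj Ki Kj) (b, z)).
Qed.

Lemma unif_step_bound i j : \forall B \near +oo, forall a x, K i x ->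
  K j (rhs S x a) ->
    forall v, `|'d (step_map i j a) (cmap (c i) x) v| <= B * `|v|.
Proof.
have H : \forall B \near +oo, transitions i j `<=` [set p |
    forall v, `|'d (step_map i j p.1) (cmap (c i) p.2) v| <= B * `|v|].
  move: (@compact_transitions i j) => /compact_near_coveringP; apply.
  move=> [a0 x0] [/= Ki Kj].
  have near0 := near_transition Ki (near_step_close ltr01 (Kdom Ki) (Kdom Kj)).
  pose b := \sum_k `|'d (step_map i j a0) (cmap (c i) x0) (delta_mx 0 k)|.
  have b_le k : `|'d (step_map i j a0) (cmap (c i) x0) (delta_mx 0 k)| <= b.
    by rewrite /b (bigD1 k) //= lerDl sumr_ge0.
  exists ([set p | step_close i j 1 a0 (cmap (c i) x0) p.1 (cmap (c i) p.2)],
    [set B | n%:R * b + 1 <= B]) => /=.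
    by split => //; apply: nbhs_pinfty_ge; exact: num_real.
  move=> [[a x] B] [/= [_ _ _ ax] bB] v.
  apply: le_trans (ler_wpM2r (normr_ge0 v) bB).
  rewrite -['d (step_map i j a) _ v](subrK ('d (step_map i j a0) (cmap (c i) x0) v)).
  apply: (le_trans (ler_normD _ _)); rewrite mulrDl addrC; apply: lerD.
    exact: linear_norm_le.
  exact: ax.
by apply: filterS H => B BP a x Ki Kj; exact: (BP (a, x)).
Qed.

(** Closeness in [M] is expressed by neighborhoods of the diagonal. This lemma and [near_chart_dist]
    translate between them and distances in the charts. *)
Lemma unif_cinv_near i (Q : set M) (W : set (M * M)) : compact Q ->
  (forall x, Q x -> \forall p \near (x, x), W p) ->
  \forall r \near (0 : R)^'+, forall x, K i x -> Q x ->
    forall z, ball (cmap (c i) x) r z -> W (x, cinv (c i) z).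
Proof.
move=> cQ QW.
have cKQ : compact (K i `&` Q).
  apply: (@subclosed_compact _ _ (K i)); [|exact: Kc|by move=> x; case].
  have hc (X : set M) : compact X -> closed X.
    exact: compact_closed (manifold_hausdorff A).
  by apply: closedI; apply: hc.
have H : \forall r \near (0 : R)^'+, K i `&` Q `<=` [set x |
    forall z, ball (cmap (c i) x) r z -> W (x, cinv (c i) z)].
  move: cKQ => /compact_near_coveringP; apply.
  move=> x0 [Ki Qx]; have [[B B'] /= [nB nB'] BB'] := QW _ Qx.
  have [[C C'] /= [nC nC'] CC'] := near_ball_swell (near_cinv (Kdom Ki) nB').
  exists (B `&` [set x | C (cmap (c i) x)], C') => /=.
    split => //; apply: filterI => //.
    exact: (cmap_continuous (Kdom Ki)).
  move=> [x r] [/= [Bx Cx] Cr] z xz.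
  by apply: (BB' (x, _)); split => //; exact: (CC' (_, _) (conj Cx Cr)).
by apply: filterS H => r rP x Ki Qx; exact: (rP x).
Qed.

(** A chart whose [K i] misses [x0] imposes nothing near [x0], because [K i] is closed. *)
Lemma near_chart_dist (r : R) (x0 : M) : 0 < r ->
  \forall p \near (x0, x0), forall i, K i p.1 ->
    cdom (c i) p.2 /\ ball (cmap (c i) p.1) r (cmap (c i) p.2).
Proof.
move=> r0.
suff H i : \forall p \near (x0, x0), K i p.1 ->
    cdom (c i) p.2 /\ ball (cmap (c i) p.1) r (cmap (c i) p.2).
  exact: (@filter_forall _ _ (fun i (p : M * M) => K i p.1 ->
    cdom (c i) p.2 /\ ball (cmap (c i) p.1) r (cmap (c i) p.2)) _ _ H).
have [Ki|nKi] := pselect (K i x0); last first.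
  have : \forall x \near x0, ~ K i x.
    apply: open_nbhs_nbhs; split => //; apply: closed_openC.
    by apply: compact_closed => //; exact: (manifold_hausdorff A).
  move=> H; have : \forall p \near (x0, x0), ~ K i p.1.
    exact: (@cvg_fst _ _ (nbhs x0) (nbhs x0) _ _ H).
  by apply: filterS => p.
have r2 : 0 < r / 2 by apply: divr_gt0.
have : \forall x \near x0, cdom (c i) x /\
    ball (cmap (c i) x0) (r / 2) (cmap (c i) x).
  apply: filterI; last by apply: (cmap_continuous (Kdom Ki)); exact: nbhsx_ballx.
  by apply: open_nbhs_nbhs; split; [exact: cdom_open|exact: Kdom].
move=> H; exists ([set x | cdom (c i) x /\
    ball (cmap (c i) x0) (r / 2) (cmap (c i) x)],
  [set x | cdom (c i) x /\
    ball (cmap (c i) x0) (r / 2) (cmap (c i) x)]) => //=.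
move=> [x y] [/= [cx bx] [cy bY]] _; split=> //.
by rewrite [r]splitr; apply: ball_triangle bY; exact: ball_sym.
Qed.

End UniformCharts.

(** * Comparison of the Riemannian norm with the coordinate norm *)

Section RiemannianNorm.
Variables (R : realType) (n : nat) (M : topologicalType).
Variables (A : smooth_manifold R n M) (g : riemannian_metric A).

Lemma rinner_sum x (J : Type) (r : seq J) (a : J -> R) (e : J -> 'rV[R]_n) w :
  rinner g x (\sum_(j <- r) a j *: e j) w = \sum_(j <- r) a j * rinner g x (e j) w.
Proof.
elim: r => [|j r IH]; last by rewrite !big_cons rinner_linear IH.
by rewrite !big_nil; have := rinner_linear g x (-1) 0 0 w; rewrite scaler0 addr0; lra.
Qed.

Lemma rnormZ x (a : R) v : rnorm g x (a *: v) = `|a| * rnorm g x v.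
Proof.
rewrite /rnorm; have Z b w w' : rinner g x (b *: w) w' = b * rinner g x w w'.
  have := rinner_sum x [:: tt] (fun=> b) (fun=> w) w'.
  by rewrite !big_seq1.
by rewrite Z (rinner_sym g) Z mulrA -expr2 sqrtrM ?sqr_ge0 // sqrtr_sqr.
Qed.

Lemma rnorm_ge0 x v : 0 <= rnorm g x v. Proof. exact: sqrtr_ge0. Qed.

Lemma chart_diff_inv c c' x : charts A c -> charts A c' -> cdom c x -> cdom c' x ->
  cancel (chart_diff c c' id x) (chart_diff c' c id x).
Proof.
move=> Ac Ac' cx c'x v.
have id1 := mdifferentiable_id A x.
have H := @chart_diff_comp _ _ _ A id id x c c' c Ac Ac' Ac id1 id1 cx c'x cx v.
by rewrite -H; exact: chart_diff_id.
Qed.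

Variables (I : finType) (c : I -> chart R n M) (K : I -> set M).
Hypotheses (Ac : forall i, charts A (c i)) (Kc : forall i, compact (K i)).
Hypothesis Kdom : forall i, K i `<=` cdom (c i).

Definition chart_rnorm i x v := rnorm g x (chart_diff (c i) (chart_at A x) id x v).

Lemma chart_rinner_continuous i (x0 : M) (v0 : 'rV[R]_n) : cdom (c i) x0 ->
  {for (x0, v0), continuous (fun p : M * 'rV[R]_n =>
    \sum_j p.2 0 j * \sum_k p.2 0 k *
      rinner g (cinv (c i) (cmap (c i) p.1))
       (tangent_of_chart A (c i) (cinv (c i) (cmap (c i) p.1)) (delta_mx 0 k))
       (tangent_of_chart A (c i) (cinv (c i) (cmap (c i) p.1)) (delta_mx 0 j)))}.
Proof.
move=> cx.
have coord (j : 'I_n) :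
    (fun p : M * 'rV[R]_n => p.2 0 j) @ nbhs (x0, v0) --> (v0 0 j : R).
  apply: (@cvg_comp _ _ _ snd (fun v : 'rV[R]_n => v 0 j)); first exact: cvg_snd.
  exact: coord_continuous.
apply: (cvg_big (op := +%R)) => [|j _]; first exact: add_continuous.
apply: cvgM; first exact: coord.
apply: (cvg_big (op := +%R)) => [|k _]; first exact: add_continuous.
apply: cvgM; first exact: coord.
apply: (@cvg_comp _ _ _ fst (fun x => rinner g (cinv (c i) (cmap (c i) x))
       (tangent_of_chart A (c i) (cinv (c i) (cmap (c i) x)) (delta_mx 0 k))
       (tangent_of_chart A (c i) (cinv (c i) (cmap (c i) x)) (delta_mx 0 j)))).
  exact: cvg_fst.
apply: (@cvg_comp _ _ _ (cmap (c i)) (fun y => rinner g (cinv (c i) y)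
       (tangent_of_chart A (c i) (cinv (c i) y) (delta_mx 0 k))
       (tangent_of_chart A (c i) (cinv (c i) y) (delta_mx 0 j)))).
  exact: cmap_continuous.
have xr : (cmap (c i) @` cdom (c i)) (cmap (c i) x0) by exists x0.
have h := @rinner_smooth _ _ _ _ g _ (Ac i) (delta_mx 0 k) (delta_mx 0 j) 0%N.
by move=> P nP; exact: (h _ xr P nP).
Qed.

Lemma chart_rinnerE i x v : cdom (c i) x ->
  rinner g x (chart_diff (c i) (chart_at A x) id x v)
    (chart_diff (c i) (chart_at A x) id x v) =
  \sum_j v 0 j * \sum_k v 0 k *
      rinner g (cinv (c i) (cmap (c i) x))
       (tangent_of_chart A (c i) (cinv (c i) (cmap (c i) x)) (delta_mx 0 k))
       (tangent_of_chart A (c i) (cinv (c i) (cmap (c i) x)) (delta_mx 0 j)).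
Proof.
move=> cx; rewrite cmapK //.
have E : chart_diff (c i) (chart_at A x) id x v =
    \sum_j v 0 j *: tangent_of_chart A (c i) x (delta_mx 0 j).
  rewrite [in LHS](row_sum_delta v) linear_sum.
  by apply: eq_bigr => j _; rewrite linearZ.
rewrite E rinner_sum; apply: eq_bigr => j _; congr (_ * _).
by rewrite rinner_sym rinner_sum.
Qed.

(** Homogeneity reduces the claim to unit vectors. On the compact product of [K i] with the sphere
    the squared norm is continuous, and it is positive since a change of charts is injective. *)
Lemma rnorm_equiv : \forall k \near +oo, forall i x v, K i x ->
  chart_rnorm i x v <= k * `|v| /\ `|v| <= k * chart_rnorm i x v.
Proof.
suff H i : \forall k \near +oo, forall x v, K i x ->
    chart_rnorm i x v <= k * `|v| /\ `|v| <= k * chart_rnorm i x v.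
  exact: (@filter_forall _ _ (fun i (k : R) => forall x v, K i x ->
    chart_rnorm i x v <= k * `|v| /\ `|v| <= k * chart_rnorm i x v) _ _ H).
pose q (p : M * 'rV[R]_n) := rinner g p.1
  (chart_diff (c i) (chart_at A p.1) id p.1 p.2)
  (chart_diff (c i) (chart_at A p.1) id p.1 p.2).
pose sphere : set 'rV[R]_n := [set v | `|v| = 1].
have cs : compact (K i `*` sphere).
  apply: compact_setX => //; apply: bounded_closed_compact.
    by exists 1; split; [exact: num_real|move=> y y1 v /= ->; exact: ltW].
  apply: (@closed_comp _ _ (fun v : 'rV[R]_n => `|v|) [set 1]).
    by move=> ? _; exact: norm_continuous.
  exact: closed_eq.
have H : \forall k \near +oo, K i `*` sphere `<=` [set p | 1 <= k * q p /\ q p <= k].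
  move: cs => /compact_near_coveringP; apply.
  move=> [x0 v0] [/= Kx v01]; have cx := Kdom Kx.
  have q0 : 0 < q (x0, v0).
    apply: rinner_pos => /=; apply/eqP => h.
    have e := chart_diff_inv (Ac i) (chart_at_charts A x0) cx (chart_at_dom A x0) v0.
    have e' := etrans (esym e) (congr1 (chart_diff (chart_at A x0) (c i) id x0) h).
    have e2 := linear0 (chart_diff (chart_at A x0) (c i) id x0).
    have v00 : v0 = 0 := etrans e' e2.
    have v1 : `|v0| = 1 := v01.
    move: v1; rewrite v00 normr0 => /eqP.
    by rewrite eq_sym oner_eq0.
  have q2 : 0 < q (x0, v0) / 2 by apply: divr_gt0.
  have := @chart_rinner_continuous i x0 v0 cx.
  move/cvgrPdist_le => /(_ _ q2) /= near1.
  have near2 : \forall p \near (x0, v0), cdom (c i) p.1.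
    have H : \forall x \near x0, cdom (c i) x.
      by apply: open_nbhs_nbhs; split; [exact: cdom_open|].
    exact: (@cvg_fst _ _ (nbhs x0) (nbhs v0) _ _ H).
  exists ([set p | `|q (x0, v0) - q p| <= q (x0, v0) / 2],
    [set k | 2 / q (x0, v0) <= k] `&` [set k | 2 * q (x0, v0) <= k]) => /=.
    split; last by apply: filterI; apply: nbhs_pinfty_ge; exact: num_real.
    apply: filterS2 near1 near2 => -[x v] /= h cx'.
    (* [chart_at A x] may jump with [x]; the continuity of [q] is visible only in the coordinate
       expression of [chart_rinnerE]. *)
    have E0 := chart_rinnerE v0 cx; have E1 := chart_rinnerE v cx'.
    by rewrite {1}/q {1}/q /= E0 E1; exact: h.
  move=> [p k] [/= + [k1 k2]]; rewrite ler_norml => /andP[h1 h2].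
  split; last by lra.
  have : 2 / q (x0, v0) * (q (x0, v0) / 2) <= k * q p.
    by apply: ler_pM; [exact: divr_ge0 (ltW q0)|lra|done|lra].
  by rewrite mulrA divfK ?gt_eqF // divff.
(* [1 <= k] lets bounds on the square pass to the norm, because then [k <= k ^+ 2]. *)
have k1 : \forall k \near +oo, (1 : R) <= k.
  by apply: nbhs_pinfty_ge; exact: num_real.
apply: filterS2 H k1 => k kP k1 x v Kx.
have [->|v0] := eqVneq v 0.
  have r0 : chart_rnorm i x 0 = 0.
    by rewrite /chart_rnorm linear0 -(scale0r (0 : 'rV[R]_n)) rnormZ normr0 mul0r.
  by rewrite r0 normr0 mulr0.
have v0' : 0 < `|v| by rewrite normr_gt0.
pose w := `|v|^-1 *: v.
have vE : v = `|v| *: w by rewrite /w scalerA divff ?scale1r // gt_eqF.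
have w1 : `|w| = 1 by rewrite /w normrZ normfV normr_id mulVf // gt_eqF.
have [h1 h2] := kP (x, w) (conj Kx w1).
have vr : chart_rnorm i x v = `|v| * chart_rnorm i x w.
  by rewrite {1}vE /chart_rnorm linearZ rnormZ normr_id.
have r0 : 0 <= chart_rnorm i x w by exact: rnorm_ge0.
have qE : q (x, w) = chart_rnorm i x w ^+ 2.
  rewrite /chart_rnorm /rnorm sqr_sqrtr //.
  have [->|wn] := eqVneq (chart_diff (c i) (chart_at A x) id x w) 0.
    by have := rinner_linear g x (-1) 0 0 0; rewrite scaler0 addr0; lra.
  exact/ltW/rinner_pos.
rewrite qE in h1 h2; rewrite vr.
have s1 : chart_rnorm i x w <= k by rewrite -ler_sqr ?nnegrE; nra.
have s2 : 1 <= k * chart_rnorm i x w.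
  by rewrite -ler_sqr ?nnegrE ?mulr_ge0 //; nra.
split; first by rewrite mulrC; apply: ler_wpM2r.
by rewrite mulrCA ler_pMr.
Qed.

End RiemannianNorm.

(** * The dichotomy along an orbit *)

Lemma daddv_pi_morph (F : fieldType) (vT : vectType F) (D : 'End(vT))
    (U1 V1 U2 V2 : {vspace vT}) (w : vT) :
  (U1 + V1 = fullv)%VS -> (U1 :&: V1 = 0)%VS -> (U2 :&: V2 = 0)%VS ->
  (D @: U1 = U2)%VS -> (D @: V1 = V2)%VS ->
  D (daddv_pi U1 V1 w) = daddv_pi U2 V2 (D w).
Proof.
move=> s1 i1 i2 DU DV.
have wE : w = daddv_pi U1 V1 w + daddv_pi V1 U1 w.
  by rewrite daddv_pi_add // s1 memvf.
rewrite {2}wE !linearD /=.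
have Da : D (daddv_pi U1 V1 w) \in U2 by rewrite -DU memv_img // memv_pi.
have Db : D (daddv_pi V1 U1 w) \in V2 by rewrite -DV memv_img // memv_pi.
rewrite (daddv_pi_id i2 Da) -[LHS]addr0; congr (_ + _).
have i2' : (V2 :&: U2 = 0)%VS by rewrite capvC.
have Db' : D (daddv_pi V1 U1 w) \in (U2 + V2)%VS.
  by rewrite -[D _]add0r memv_add // mem0v.
have := daddv_pi_add i2 Db'; rewrite (daddv_pi_id i2' Db).
move=> /(congr1 (fun x => x - D (daddv_pi V1 U1 w))).
by rewrite addrK subrr => ->.
Qed.

Section MdiffChart.
Variables (R : realType) (n : nat) (M : topologicalType).
Variable A : smooth_manifold R n M.

Lemma mdiff_chart (F : M -> M) (x : M) (c c' : chart R n M) v :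
  charts A c -> charts A c' -> mdifferentiable A F x ->
  cdom c x -> cdom c' (F x) ->
  mdiff A F x (chart_diff c (chart_at A x) id x v) =
    chart_diff c' (chart_at A (F x)) id (F x) (chart_diff c c' F x v).
Proof.
move=> Ac Ac' dF cx c'x; rewrite mdiffE.
have Ax := chart_at_charts A x; have dx := chart_at_dom A x.
have Ay := chart_at_charts A (F x); have dy := chart_at_dom A (F x).
have idx := mdifferentiable_id A x; have idy := mdifferentiable_id A (F x).
have e1 := @chart_diff_comp _ _ _ A id F x _ _ _ Ac Ax Ay idx dF cx dx dy v.
have e2 := @chart_diff_comp _ _ _ A F id x _ _ _ Ac Ac' Ay dF idy cx c'x dy v.
exact: etrans (esym e1) e2.
Qed.

End MdiffChart.

Section ChartDichotomy.
Variables (R : realType) (n : nat) (M : topologicalType).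
Variables (A : smooth_manifold R n M) (g : riemannian_metric A).
Variables (U : metricType R) (S : control_system A U) (Q : set M).
Hypothesis U_compact : compact [set: U].
Hypothesis Q_hyperbolic : hyperbolic_set S g Q.
Variables (I : finType) (c : I -> chart R n M) (K : I -> set M).
Hypotheses (Ac : forall i, charts A (c i)) (Kc : forall i, compact (K i)).
Hypothesis Kdom : forall i, K i `<=` cdom (c i).

Definition chart_linearization (iota : nat -> I) (u : control_seq U) (x : M)
    (t : nat) : 'End('rV[R]_n) :=
  linfun ('d (step_map S c (iota t) (iota t.+1) (u t%:Z))
             (cmap (c (iota t)) (phi S t%:Z x u))).

(** The splitting is conjugated from the frames [chart_at] to the charts [c (iota t)]. Norms are
    compared once before and once after the evolution, which turns [c0] into
    [kappa * c0 * kappa]. *)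
Lemma chart_dichotomy : exists C l : R, [/\ 0 <= C, 0 < l < 1 &
  forall (u : control_seq U) (x : M) (iota : nat -> I),
    all_time_lift S Q (u, x) -> (forall t : nat, K (iota t) (phi S t%:Z x u)) ->
    exists G, green_function C l (chart_linearization iota u x) G].
Proof.
have [_ _ _ [Em [Ep [split_E inv_E [c0 [l [c1 l01 hyp_E]]] _]]]] := Q_hyperbolic.
have [kappa [k1 kP]] : exists kappa : R, 1 <= kappa /\
    forall i x v, K i x -> chart_rnorm g c i x v <= kappa * `|v| /\
      `|v| <= kappa * chart_rnorm g c i x v.
  have h1 : \forall k \near +oo, (1 : R) <= k.
    by apply: nbhs_pinfty_ge; exact: num_real.
  by have [k] := filter_ex (filterI h1 (rnorm_equiv g Ac Kc Kdom)); exists k.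
have [B [B0 BP]] : exists B : R, 0 <= B /\ forall i j a x, K i x ->
    K j (rhs S x a) ->
    forall v, `|'d (step_map S c i j a) (cmap (c i) x) v| <= B * `|v|.
  have h0 : \forall k \near +oo, (0 : R) <= k.
    by apply: nbhs_pinfty_ge; exact: num_real.
  have hB : \forall B \near +oo, forall i j a x, K i x -> K j (rhs S x a) ->
    forall v, `|'d (step_map S c i j a) (cmap (c i) x) v| <= B * `|v|.
    apply: (@filter_forall _ _ (fun i B => forall j a x, K i x ->
      K j (rhs S x a) ->
      forall v, `|'d (step_map S c i j a) (cmap (c i) x) v| <= B * `|v|)) => i.
    apply: (@filter_forall _ _ (fun j B => forall a x, K i x ->
      K j (rhs S x a) ->
      forall v, `|'d (step_map S c i j a) (cmap (c i) x) v| <= B * `|v|)) => j.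
    exact: unif_step_bound.
  by have [B] := filter_ex (filterI h0 hB); exists B.
have kk0 : 0 <= kappa * c0 * kappa by rewrite !mulr_ge0 //; lra.
have [C C0 CP] := @dichotomy_green R n _ l _ kk0 B0 l01.
exists C, l; split=> // u x iota ux KI.
pose X t := phi S t%:Z x u; pose cc t := c (iota t).
pose z t : control_seq U * M := (shift_seq t%:Z u, X t).
have zL t : all_time_lift S Q (z t) by exact: lift_flow.
have dX t : cdom (cc t) (X t) by exact/Kdom/KI.
(* The evolution from time [s] to time [t] along the control; the integer difference includes
   backward evolution. *)
pose F t s : M -> M := phi S (t%:Z - s%:Z) ^~ (shift_seq s%:Z u).
have FX t s : F t s (X s) = X t by rewrite /F /X -phiD subrK.
have FF r t s : F r t \o F t s = F r s.
  apply/funext => y; rewrite /F /=.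
  have -> : r%:Z - s%:Z = (r%:Z - t%:Z) + (t%:Z - s%:Z) by rewrite addrA subrK.
  by rewrite [RHS]phiD shift_seqD subrK.
have dF t s y : mdifferentiable A (F t s) y by exact: phi_mdifferentiable.
pose D t s := mdiff A (F t s) (X s).
(* [T t] passes from the chart of time [t] to the frame [chart_at A (X t)], and [T'] goes back. *)
have [T TE] : exists T : nat -> 'End('rV[R]_n), forall t v,
    T t v = chart_diff (cc t) (chart_at A (X t)) id (X t) v.
  by exists (fun t => linfun (chart_diff (cc t) (chart_at A (X t)) id (X t)));
    move=> t v; exact: lfunE.
have [T' T'E] : exists T' : nat -> 'End('rV[R]_n), forall t v,
    T' t v = chart_diff (chart_at A (X t)) (cc t) id (X t) v.
  by exists (fun t => linfun (chart_diff (chart_at A (X t)) (cc t) id (X t)));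
    move=> t v; exact: lfunE.
have [E EE] : exists E : nat -> nat -> 'End('rV[R]_n), forall t s v,
    E t s v = chart_diff (cc s) (cc t) (F t s) (X s) v.
  by exists (fun t s => linfun (chart_diff (cc s) (cc t) (F t s) (X s)));
    move=> t s v; exact: lfunE.
have TK t v : T' t (T t v) = v.
  rewrite T'E TE.
  exact: (chart_diff_inv (Ac _) (chart_at_charts A _) (dX t) (chart_at_dom A _)).
have T'K t v : T t (T' t v) = v.
  rewrite T'E TE.
  exact: (chart_diff_inv (chart_at_charts A _) (Ac _) (chart_at_dom A _) (dX t)).
have DT t s v : D t s (T s v) = T t (E t s v).
  have dFX : cdom (cc t) (F t s (X s)) by rewrite FX.
  have e := mdiff_chart v (Ac (iota s)) (Ac (iota t)) (dF t s (X s)) (dX s) dFX.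
  rewrite FX in e.
  by rewrite (TE s) (TE t) EE; exact: e.
have flowE t s : control_flow S (t%:Z - s%:Z) (z s) = z t.
  by rewrite /control_flow /z /= shift_seqD subrK -/(F t s (X s)) FX.
have [DEm DEp] : (forall t s, (D t s @: Em (z s))%VS = Em (z t)) /\
    (forall t s, (D t s @: Ep (z s))%VS = Ep (z t)).
  by split=> t s; have := inv_E _ _ (t%:Z - s%:Z) (zL s);
    rewrite -/(z s) flowE => -[].
have i0 t : (Ep (z t) :&: Em (z t) = 0)%VS by rewrite capvC; case: (split_E _ (zL t)).
have s0 t : (Ep (z t) + Em (z t) = fullv)%VS by rewrite addvC; case: (split_E _ (zL t)).
pose Mm t := daddv_pi (Em (z t)) (Ep (z t)).
pose Mp t := daddv_pi (Ep (z t)) (Em (z t)).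
pose Pm t := (T' t \o Mm t \o T t)%VF.
pose Pp t := (T' t \o Mp t \o T t)%VF.
have ET t s v : E t s (T' s v) = T' t (D t s v).
  by rewrite -[in RHS](T'K s v) DT TK.
have norm_T t v : rnorm g (X t) (T t v) <= kappa * `|v| /\
    `|v| <= kappa * rnorm g (X t) (T t v).
  by rewrite TE; exact: kP.
have DMm t s v : D t s (Mm s v) = Mm t (D t s v).
  by apply: daddv_pi_morph => //; case: (split_E _ (zL s)) => //;
    case: (split_E _ (zL t)).
have DMp t s v : D t s (Mp s v) = Mp t (D t s v).
  by apply: daddv_pi_morph.
apply: (CP _ E Pm Pp).
  move=> t v; rewrite lfunE; apply: BP; first exact: KI.
  by rewrite -phiS -PoszD addn1; exact: KI.
split.
- split=> [t v|r t s v|t v].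
  + rewrite EE.
    have -> : F t t = id by apply/funext => y; rewrite /F subrr.
    exact: chart_diff_id.
  + rewrite !EE.
    have dFX : cdom (cc t) (F t s (X s)) by rewrite FX.
    have dFX' : cdom (cc r) (F r t (F t s (X s))) by rewrite !FX.
    have e := chart_diff_comp (Ac (iota s)) (Ac (iota t)) (Ac (iota r))
      (dF t s (X s)) (dF r t _) (dX s) dFX dFX' v.
    by rewrite FF FX in e; exact: esym e.
  + have F1 : F t.+1 t = rhs S ^~ (u t%:Z).
      by rewrite /F -addn1 PoszD addrAC subrr add0r phiE1.
    rewrite EE F1 /chart_linearization; exact: esym (lfunE _ v).
- split=> [t v|t v|t s v|t s v].
  + rewrite !comp_lfunE -linearD addrC /= daddv_pi_add ?TK //.
    by rewrite s0 memvf.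
  + by rewrite !comp_lfunE T'K daddv_pi_proj.
  + by rewrite !comp_lfunE ET DMm DT.
  + by rewrite !comp_lfunE ET DMp DT.
- move=> t s v st.
  have h : T s (Pm s v) \in Em (z s) by rewrite !comp_lfunE T'K memv_pi.
  have [+ _] := hyp_E _ _ (t - s)%N (zL s).
  move=> /(_ _ h); rewrite -subzn // -/(F t s) -/(D t s) DT.
  rewrite -/(F t s (X s)) FX => h1.
  have [_ h2] := norm_T t (E t s (Pm s v)); have [h3 _] := norm_T s (Pm s v).
  apply: (le_trans h2).
  have k0 : 0 <= kappa by lra.
  apply: (le_trans (ler_wpM2l k0 h1)).
  have q0 : 0 <= c0 * l ^+ (t - s).
    by apply/mulr_ge0/exprn_ge0; case/andP: l01 => *; lra.
  have := ler_wpM2l (mulr_ge0 k0 q0) h3; rewrite -!mulrA.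
  by move=> /le_trans; apply; rewrite le_eqVlt; apply/orP; left; apply/eqP; ring.
- move=> t s v ts.
  have h : T s (Pp s v) \in Ep (z s) by rewrite !comp_lfunE T'K memv_pi.
  have [_ +] := hyp_E _ _ (s - t)%N (zL s).
  move=> /(_ _ h); rewrite -subzn // opprB -/(F t s) -/(D t s) DT.
  rewrite -/(F t s (X s)) FX => h1.
  have [_ h2] := norm_T t (E t s (Pp s v)); have [h3 _] := norm_T s (Pp s v).
  apply: (le_trans h2).
  have k0 : 0 <= kappa by lra.
  apply: (le_trans (ler_wpM2l k0 h1)).
  have q0 : 0 <= c0 * l ^+ (s - t).
    by apply/mulr_ge0/exprn_ge0; case/andP: l01 => *; lra.
  have := ler_wpM2l (mulr_ge0 k0 q0) h3; rewrite -!mulrA.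
  by move=> /le_trans; apply; rewrite le_eqVlt; apply/orP; left; apply/eqP; ring.
Qed.

End ChartDichotomy.

(** * Shadowing and expansivity *)

Section Shadowing.
Variables (R : realType) (n : nat) (M : topologicalType).
Variables (A : smooth_manifold R n M) (g : riemannian_metric A).
Variables (U : metricType R) (S : control_system A U) (Q : set M).
Hypothesis U_compact : compact [set: U].
Hypothesis Q_hyperbolic : hyperbolic_set S g Q.
Variables (I : finType) (c : I -> chart R n M) (K : I -> set M).
Hypotheses (Ac : forall i, charts A (c i)) (Kc : forall i, compact (K i)).
Hypothesis Kdom : forall i, K i `<=` cdom (c i).
Hypothesis Qcover : forall x, Q x -> exists i, K i x.

Let Q_compact : compact Q. Proof. by case: Q_hyperbolic. Qed.

Lemma unif_step_lipschitz (eta : R) : 0 < eta ->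
  \forall r \near (0 : R)^'+, forall i j a x, K i x -> K j (rhs S x a) ->
    forall b, ball a r b ->
    (forall z, ball (cmap (c i) x) r z -> step_close S c i j eta a (cmap (c i) x) b z) /\
    (forall z z', ball (cmap (c i) x) r z -> ball (cmap (c i) x) r z' ->
      `|step_map S c i j b z - step_map S c i j b z' -
        'd (step_map S c i j a) (cmap (c i) x) (z - z')| <= eta * `|z - z'|).
Proof.
move=> eta0.
have : \forall r \near (0 : R)^'+, forall i j a x, K i x -> K j (rhs S x a) ->
    forall b z, ball a r b -> ball (cmap (c i) x) r z ->
      step_close S c i j eta a (cmap (c i) x) b z.
  apply: (@filter_forall _ _ (fun i r => forall j a x, K i x ->
    K j (rhs S x a) -> forall b z, ball a r b -> ball (cmap (c i) x) r z ->
      step_close S c i j eta a (cmap (c i) x) b z)) => i.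
  apply: (@filter_forall _ _ (fun j r => forall a x, K i x ->
    K j (rhs S x a) -> forall b z, ball a r b -> ball (cmap (c i) x) r z ->
      step_close S c i j eta a (cmap (c i) x) b z)) => j.
  exact: unif_step_close.
apply: filterS => r rP i j a x Ki Kj b ab.
have close z : ball (cmap (c i) x) r z ->
    step_close S c i j eta a (cmap (c i) x) b z by exact: rP.
split=> // z z' xz xz'; apply: (mean_value_ball _ _ xz xz') => y.
  move=> /close[yr yj _ _]; have [cy yE] := cinv_range yr.
  have := (C1_mdifferentiable (cinv (c i) y) (rhs_C1 S b)).2 _ _ (Ac i) (Ac j) cy yj.
  by rewrite yE.
by move=> v /close[_ _ _]; exact.
Qed.

Lemma orbit_charts (u : control_seq U) (x : M) : all_time_lift S Q (u, x) ->
  exists iota : int -> I, forall t, K (iota t) (phi S t x u).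
Proof.
move=> ux; have [iota KI] := choice (fun t => Qcover (ux t)).
by exists iota.
Qed.

Lemma step_mapE i j b x : cdom (c i) x ->
  step_map S c i j b (cmap (c i) x) = cmap (c j) (rhs S x b).
Proof. by move=> cx; rewrite /step_map /= cmapK. Qed.

(** [delta] is chosen before [N], so that the windows can later grow with a fixed [delta]. *)
Lemma finite_shadowing (W : set (M * M)) :
  (forall x, Q x -> \forall p \near (x, x), W p) ->
  exists2 delta : R, 0 < delta &
    forall (N : nat) (u v : control_seq U) (x : M),
      all_time_lift S Q (u, x) -> (forall t, ball (u t) delta (v t)) ->
      exists y, forall t : nat, (t <= N)%N ->
        W (phi S t%:Z x u, phi S t%:Z y v).
Proof.
move=> QW.
have [C [l [C0 l01 CP]]] :=
  chart_dichotomy U_compact Q_hyperbolic Ac Kc Kdom.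
have K0 : 0 <= C * (2 / (1 - l)).
  by case/andP: l01 => *; apply/mulr_ge0/divr_ge0 => //; lra.
pose k := C * (2 / (1 - l)).
pose eta := (2 * (k + 1))^-1.
have eta0 : 0 < eta by rewrite invr_gt0 mulr_gt0 //; rewrite /k; lra.
have keta : k * eta <= 2^-1.
  rewrite /eta invfM mulrCA ger_pMr ?invr_gt0 // ler_pdivrMr /k; lra.
have hW : \forall r \near (0 : R)^'+, forall i x, K i x -> Q x ->
    forall z, ball (cmap (c i) x) r z -> W (x, cinv (c i) z).
  apply: (@filter_forall _ _ (fun i r => forall x, K i x -> Q x ->
    forall z, ball (cmap (c i) x) r z -> W (x, cinv (c i) z))) => i.
  exact: unif_cinv_near.
have r_gt0 : \forall r \near (0 : R)^'+, 0 < r by exact: nbhs_right_gt.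
have [r [[r0 rW] rL]] := filter_ex
  (filterI (filterI r_gt0 hW) (unif_step_lipschitz eta0)).
(* The closed ball of radius [r'] lies in the open ball of radius [r], where increments are
   [eta]-close to the linearization. The smaller [d] below makes replacing [u] by [v] cost at most
   [e] in one step along the orbit. *)
pose r' := r / 2; have r'0 : 0 < r' by apply: divr_gt0.
pose e := r' * eta; have e0 : 0 < e by apply: mulr_gt0.
have ke : k * e <= r' / 2 by rewrite /e mulrCA; apply: ler_wpM2l => //; exact: ltW.
have d_le : \forall d \near (0 : R)^'+, d <= r by exact: nbhs_right_le.
have [d [[d0 dr] dL]] := filter_ex
  (filterI (filterI r_gt0 d_le) (unif_step_lipschitz e0)).
exists d => // N u v x ux uv.
have [iota KI] := orbit_charts ux.
pose io (t : nat) := iota t%:Z.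
pose X (t : nat) := phi S t%:Z x u.
pose p t := cmap (c (io t)) (X t).
have XS t : rhs S (X t) (u t%:Z) = X t.+1 by rewrite /X -addn1 PoszD phiS.
have KX t : K (io t) (X t) by exact: KI.
have KXS t : K (io t.+1) (rhs S (X t) (u t%:Z)) by rewrite XS.
have [G GP] := CP u x io ux KX.
pose L := chart_linearization S c io u x.
have LE t w : L t w = 'd (step_map S c (io t) (io t.+1) (u t%:Z)) (p t) w by exact: lfunE.
pose f t := step_map S c (io t) (io t.+1) (v t%:Z).
(* In coordinates centred at the orbit of [(u, x)], the orbits of [v] solve
   [z (t+1) = L t (z t) + h t (z t)], and [h t 0] is the one-step error of the pseudo-orbit. *)
pose h t w := f t (p t + w) - p t.+1 - L t w.
have uvr t : ball (u t) r (v t) by exact: le_ball (uv t).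
have in_ball t w : `|w| <= r' -> ball (p t) r (p t + w).
  move=> wr; rewrite -ball_normE /ball_ /= opprD addNKr normrN.
  by apply: (le_lt_trans wr); rewrite /r' ltr_pdivrMr // ltr_pMr // ltr1n.
have h0 t : `|h t 0| <= e.
  rewrite /h linear0 subr0 addr0.
  have [H _] := dL _ _ _ _ (KX t) (KXS t) _ (uv t%:Z).
  have [_ _ H1 _] := H _ (ballxx _ d0).
  by move: H1; rewrite (step_mapE _ (u t%:Z)) ?XS //; exact: Kdom.
have hl t w w' : `|w| <= r' -> `|w'| <= r' -> `|h t w - h t w'| <= eta * `|w - w'|.
  move=> wr wr'.
  have [_ H] := rL _ _ _ _ (KX t) (KXS t) _ (uvr t%:Z).
  have := H _ _ (in_ball t _ wr) (in_ball t _ wr').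
  rewrite -/(f t) -LE.
  have -> : p t + w - (p t + w') = w - w' by rewrite opprD addrACA subrr add0r.
  have -> // : h t w - h t w' = f t (p t + w) - f t (p t + w') - L t (w - w').
  have sub_cancel (a b a' b' q : 'rV[R]_n) :
      a - q - a' - (b - q - b') = a - b - (a' - b').
    by apply/rowP => i; rewrite !mxE; ring.
  by rewrite /h (linearB (L t)) sub_cancel.
have [z [zr zS]] := green_shadowing C0 l01 GP N r'0 (ltW e0) (ltW eta0) h0 hl keta ke.
exists (cinv (c (io 0%N)) (p 0%N + z 0%N)) => t tN.
suff -> : phi S t%:Z (cinv (c (io 0%N)) (p 0%N + z 0%N)) v = cinv (c (io t)) (p t + z t).
  by apply: rW; [exact: KX | exact: ux | exact: in_ball].
elim: t tN => [|t IH] tN; first by rewrite phi0.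
rewrite -addn1 PoszD phiS IH ?(ltnW tN) // addn1.
have [H _] := rL _ _ _ _ (KX t) (KXS t) _ (uvr t%:Z).
have [_ Hj _ _] := H _ (in_ball t _ (zr t)).
rewrite -(cmapK Hj); congr (cinv _ _).
have add_cancel (a b l' : 'rV[R]_n) : a = b + (l' + (a - b - l')).
  by rewrite addrC subrKC subrK.
rewrite zS // /h; exact: add_cancel.
Qed.

(** In the charts, the difference of two shadowing orbits is bounded and almost solves the
    linearized equation. [green_expansive], on a window centred at an arbitrary time, halves any
    uniform bound on it, so it vanishes. *)
Lemma expansivity : exists2 W : set (M * M),
  forall x, Q x -> \forall p \near (x, x), W p &
  exists2 delta : R, 0 < delta &
    forall (u v : control_seq U) (x y y' : M),
      all_time_lift S Q (u, x) -> (forall t, ball (u t) delta (v t)) ->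
      (forall t, W (phi S t x u, phi S t y v)) ->
      (forall t, W (phi S t x u, phi S t y' v)) -> y = y'.
Proof.
have [C [l [C0 l01 CP]]] :=
  chart_dichotomy U_compact Q_hyperbolic Ac Kc Kdom.
have K0 : 0 <= C * (2 / (1 - l)).
  by case/andP: l01 => *; apply/mulr_ge0/divr_ge0 => //; lra.
pose k := C * (2 / (1 - l)).
(* The defects and the two boundary terms may each contribute 1/4, which adds up to the factor 1/2
   of [halve]. *)
pose eta := (4 * (k + 1))^-1.
have eta0 : 0 < eta by rewrite invr_gt0 mulr_gt0 //; rewrite /k; lra.
have keta : k * eta <= 4^-1.
  rewrite /eta invfM mulrCA ger_pMr ?invr_gt0 // ler_pdivrMr /k; lra.
have [N N0 lN] : exists2 N, (0 < N)%N & 2 * C * l ^+ N <= 4^-1.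
  have [l0 l1] := andP l01.
  have /cvgrPdist_lt /(_ (8^-1 / (C + 1))) : l ^+ m @[m --> \oo] --> (0 : R).
    by apply: cvg_expr; rewrite ger0_norm // ltW.
  move=> /(_ _)[|T _ /(_ T.+1 (leqnSn _))]; first by apply: divr_gt0; lra.
  rewrite sub0r normrN ger0_norm; last exact/exprn_ge0/ltW.
  rewrite ltr_pdivlMr; last by lra.
  by have := exprn_ge0 T.+1 (ltW l0); exists T.+1 => //; nra.
have r_gt0 : \forall r \near (0 : R)^'+, 0 < r by exact: nbhs_right_gt.
have [r [r0 rL]] := filter_ex (filterI r_gt0 (unif_step_lipschitz eta0)).
exists [set p | forall i, K i p.1 -> cdom (c i) p.2 /\
    ball (cmap (c i) p.1) r (cmap (c i) p.2)].
  by move=> x _; exact: (near_chart_dist A Kc Kdom x r0).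
exists r => // u v x y y' ux uv yW y'W.
have [iota KI] := orbit_charts ux.
pose cc t := c (iota t).
pose d t := cmap (cc t) (phi S t y v) - cmap (cc t) (phi S t y' v).
have d_bound t : `|d t| <= r + r.
  have [_ b1] := yW t _ (KI t); have [_ b2] := y'W t _ (KI t).
  move: b1 b2; rewrite -!ball_normE /ball_ /= => b1 b2.
  apply: (le_trans (ler_distD (cmap (cc t) (phi S t x u)) _ _)).
  by rewrite distrC; apply: lerD; exact: ltW.
have halve (D : R) : 0 <= D -> (forall t, `|d t| <= D) ->
    forall t, `|d t| <= D / 2.
  move=> D0 dD t; pose s := t - N%:Z.
  pose X (k : nat) := phi S k%:Z (phi S s x u) (shift_seq s u).
  have XE (m : nat) : X m = phi S (m%:Z + s) x u by rewrite /X phiD.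
  have ux' : all_time_lift S Q (shift_seq s u, phi S s x u) by exact: lift_flow.
  pose io (m : nat) := iota (m%:Z + s).
  have KX (m : nat) : K (io m) (X m) by rewrite XE; exact: KI.
  have [G GP] := CP _ _ io ux' KX.
  have H := @green_expansive _ _ _ _ _ _ C0 l01 GP N (fun m : nat => d (m%:Z + s))
    D eta N0 (ltW eta0) D0 (fun m _ => dD _).
  have sE : N%:Z + s = t by rewrite /s addrC subrK.
  rewrite sE in H; apply: (le_trans (H _)); last first.
    by rewrite [D / 2]mulrC; apply: ler_wpM2r => //; move: keta lN; rewrite /k; lra.
  move=> m _; apply: le_trans (ler_wpM2l (ltW eta0) (dD (m%:Z + s))).
  have XS : rhs S (X m) (shift_seq s u m%:Z) = X m.+1.
    by rewrite /X -addn1 PoszD phiS.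
  have KXS : K (io m.+1) (rhs S (X m) (shift_seq s u m%:Z)) by rewrite XS.
  have [_ HL] := rL _ _ _ _ (KX m) KXS _ (uv (m%:Z + s)).
  have [c1 b1] := yW _ _ (KI (m%:Z + s)); have [c2 b2] := y'W _ _ (KI (m%:Z + s)).
  rewrite -XE in b1 b2.
  have := HL _ _ b1 b2.
  rewrite !step_mapE // -!phiS.
  have -> : chart_linearization S c io (shift_seq s u) (phi S s x u) m (d (m%:Z + s)) =
    'd (step_map S c (io m) (io m.+1) (shift_seq s u m%:Z)) (cmap (c (io m)) (X m))
      (d (m%:Z + s)) by exact: lfunE.
  have eS : m%:Z + s + 1 = m.+1%:Z + s by rewrite addrAC -PoszD addn1.
  by rewrite eS.
have d_iter j t : `|d t| <= (r + r) / 2 ^+ j.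
  elim: j t => [|j IH] t; first by rewrite expr0 divr1.
  rewrite exprSr invfM mulrA; apply: halve => //.
  by apply: divr_ge0; [lra | exact: exprn_ge0].
have d0 : d 0 = 0.
  apply/eqP; rewrite -normr_le0; apply/ler_addgt0Pr => e e0; rewrite add0r.
  have /cvgrPdist_lt /(_ (e / (r + r))) : (2^-1 : R) ^+ m @[m --> \oo] --> (0 : R).
    by apply: cvg_expr; rewrite ger0_norm; lra.
  move=> /(_ _)[|T _ /(_ T (leqnn _))]; first by apply: divr_gt0 => //; lra.
  rewrite sub0r normrN ger0_norm; last by apply: exprn_ge0; lra.
  rewrite ltr_pdivlMr; last by lra.
  by move=> h; apply: (le_trans (d_iter T 0)); rewrite mulrC -exprVn; exact: ltW.
have [c1 _] := yW 0 _ (KI 0); have [c2 _] := y'W 0 _ (KI 0).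
rewrite -[y](cmapK c1) -[y'](cmapK c2) /=; congr (cinv _ _).
by apply/eqP; rewrite -subr_eq0; apply/eqP.
Qed.

End Shadowing.

(** * Uniformly close controls and neighborhoods of the diagonal *)

Section ControlSequences.
Variables (R : realType) (U : metricType R).

(** Stronger than closeness in the product topology, and invariant under the shift. *)
Definition uclose (d : R) (u v : control_seq U) := forall t, ball (u t) d (v t).

Lemma uclose_sym d u v : uclose d u v -> uclose d v u.
Proof. by move=> uv t; exact: ball_sym. Qed.

Lemma uclose_le d e u v : d <= e -> uclose d u v -> uclose e u v.
Proof. by move=> de uv t; exact: le_ball (uv t). Qed.

Lemma uclose_shift d u v s : uclose d u v -> uclose d (shift_seq s u) (shift_seq s v).
Proof. by move=> uv t; exact: uv. Qed.

Lemma control_seq_compact : compact [set: U] -> compact [set: control_seq U].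
Proof.
move=> cU; have -> : [set: control_seq U] =
    [set f : control_seq U | forall i : int, [set: U] (f i)].
  by apply/seteqP; split.
exact: (@tychonoff int (fun=> U) (fun=> setT) (fun=> cU)).
Qed.

Lemma near_uclose (u0 : control_seq U) (P : set (control_seq U)) :
  nbhs u0 P ->
  \forall u \near u0 & d \near (0 : R)^'+, forall v, uclose d u v -> P v.
Proof.
(* The sets [P] with the desired property form a filter, so its convergence to [u0] need only be
   checked on subbasic neighborhoods, each constraining a single time. *)
pose F : set_system (control_seq U) := [set P : set (control_seq U) |
  \forall u \near u0 & d \near (0 : R)^'+, forall v, uclose d u v -> P v].
have FF : Filter F.
  split.
  - rewrite /F /=; by apply: filterE => -[u d].
  - move=> X Y; rewrite /F /= => FX FY; apply: filterS2 FX FY => -[u d] /= hX hY v uv.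
    by split; [exact: hX | exact: hY].
  - by move=> X Y XY; rewrite /F /=; apply: filterS => -[u d] /= hX v uv; exact/XY/hX.
have : F --> u0.
  apply/cvg_sup => t X /= [_ [[B oB <-] Bu BX]].
  have /nbhs_ballP[e /= e0 eB] : nbhs (u0 t) B by apply: open_nbhs_nbhs.
  have e2 : 0 < e / 2 by apply: divr_gt0.
  have h1 : nbhs u0 [set u : control_seq U | ball (u0 t) (e / 2) (u t)].
    by apply: (@proj_continuous _ (fun=> U) t u0); exact: nbhsx_ballx.
  have h2 : \forall d \near (0 : R)^'+, d <= e / 2 by exact: nbhs_right_le.
  exists ([set u : control_seq U | ball (u0 t) (e / 2) (u t)],
    [set d | d <= e / 2]) => //.
  move=> [u d] [/= hu hd] v uv; apply: BX; apply: eB; rewrite [e]splitr.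
  by apply: ball_triangle hu _; exact: le_ball (uv t).
by move=> h /h.
Qed.

End ControlSequences.

(** * Neighborhoods of the diagonal over a compact set *)

Section DiagonalNeighborhoods.
Variables (R : realType) (n : nat) (M : topologicalType).
Variables (A : smooth_manifold R n M) (Q : set M).
Hypothesis Q_compact : compact Q.

Definition diag_nbhs (W : set (M * M)) :=
  forall x, Q x -> \forall p \near (x, x), W p.

Lemma diag_nbhsI W W' : diag_nbhs W -> diag_nbhs W' -> diag_nbhs (W `&` W').
Proof. by move=> h h' x Qx; apply: filterI; [exact: h | exact: h']. Qed.

Lemma near_swap (x : M) (W : set (M * M)) : (\forall p \near (x, x), W p) ->
  \forall p \near (x, x), W (p.2, p.1).
Proof.
move=> [[B C] /= [nB nC] BC]; exists (C, B) => //= -[y z] [/= Cy Bz].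
exact: (BC (z, y)).
Qed.

Lemma near_diagonal (x : M) (W : set (M * M)) : (\forall p \near (x, x), W p) ->
  \forall y \near x, \forall p \near (y, y), W p.
Proof.
move=> /near_join [[B C] /= [nB nC] BC].
by apply: filterS2 nB nC => y By Cy; exact: (BC (y, y)).
Qed.

(** Closedness of [W'] lets the shadowing relation pass to limits, and [Z] confines all shadowing
    points to a compact set, where such limits exist. *)
Lemma closed_diag_nbhs (W : set (M * M)) : diag_nbhs W ->
  exists (W' : set (M * M)) (Z : set M), [/\ diag_nbhs W', closed W',
    W' `<=` W, compact Z & forall p, W' p -> Z p.2].
Proof.
move=> hW.
have local x : exists C : set (M * M) * set M, [/\ closed C.1, C.1 `<=` W,
    compact C.2, forall p, C.1 p -> C.2 p.2
    & Q x -> \forall p \near (x, x), C.1 p].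
  have [Qx|nQx] := pselect (Q x); last first.
    by exists (set0, set0); split=> //; [exact: closed0 | exact: compact0].
  have [[B C] /= [nB nC] BC] := hW x Qx.
  have [V [cV nV _]] := compact_chart_neighborhood A x.
  have [B' nB' B'B] := compact_regular (manifold_hausdorff A) cV nV nB.
  have [C' nC' C'C] := compact_regular (manifold_hausdorff A) cV nV (filterI nC nV).
  exists (closure B' `*` closure C', closure C'); split => /=.
  - have -> : closure B' `*` closure C' =
        (fst @^-1` closure B') `&` (snd @^-1` closure C') :> set (M * M) by [].
    by apply: closedI; apply: closed_comp (@closed_closure _ _) => p _;
      [exact: cvg_fst|exact: cvg_snd].
  - by move=> p [/B'B Bp /C'C[Cp _]]; exact: BC.
  - by apply: (subclosed_compact (@closed_closure _ _) cV) => y /C'C[].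
  - by move=> p [].
  - move=> _; exists (B', C') => //= p [/= ? ?].
    by split; exact: subset_closure.
have [C CP] := choice local.
have [s sQ] : exists s : seq M, forall x, Q x -> exists2 q, q \in s &
    \forall p \near (x, x), (C q).1 p.
  apply: (@compact_nbhs_cover _ _ (fun q => [set x |
    \forall p \near (x, x), (C q).1 p])) => // x Qx.
  by apply: near_diagonal; case: (CP x) => _ _ _ _; exact.
exists (\big[setU/set0]_(q <- s) (C q).1), (\big[setU/set0]_(q <- s) (C q).2).
split.
- move=> x /sQ[q qs]; apply: filterS => p Cp.
  by rewrite -bigcup_seq; exists q.
- by apply: closed_bigsetU => q _; case: (CP q).
- by move=> p; rewrite -bigcup_seq => -[q _]; case: (CP q) => _ h _ _ _; exact: h.
- by apply: bigsetU_compact => q _; case: (CP q).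
- move=> p; rewrite -!bigcup_seq => -[q qs Cp]; exists q => //.
  by case: (CP q) => _ _ _ h _; exact: h.
Qed.

End DiagonalNeighborhoods.

(** * Homeomorphic subspaces, closed graphs and chains of controls *)

Lemma homeomorphic_sym (T T' : topologicalType) (A : set T) (B : set T') :
  homeomorphic A B -> homeomorphic B A.
Proof. by move=> [h [k [[? ?] [? ?] ? ?]]]; exists k, h; split. Qed.

Lemma within_continuous_comp (T1 T2 T3 : topologicalType) (A : set T1)
    (B : set T2) (f : T1 -> T2) (g : T2 -> T3) :
  (forall x, A x -> B (f x)) -> {within A, continuous f} ->
  {within B, continuous g} -> {within A, continuous (g \o f)}.
Proof.
move=> AB /subspace_continuousP cf /subspace_continuousP cg.
apply/subspace_continuousP => x Ax P /(cg _ (AB _ Ax)) /(cf _ Ax) h.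
by apply: (@filterS _ (nbhs x) _ _ _ _ h) => y hy Ay; apply: hy => //; exact: AB.
Qed.

Lemma homeomorphic_trans (T1 T2 T3 : topologicalType) (A : set T1)
    (B : set T2) (C : set T3) :
  homeomorphic A B -> homeomorphic B C -> homeomorphic A C.
Proof.
move=> [h [k [[AB BA] [kh hk] ch ck]]] [h' [k' [[BC CB] [kh' hk'] ch' ck']]].
exists (h' \o h), (k \o k'); split.
- by split=> x Hx /=; [apply/BC/AB | apply/BA/CB].
- split=> x Hx /=; first by rewrite kh' ?kh //; exact: AB.
  by rewrite hk ?hk' //; exact: CB.
- exact: within_continuous_comp ch ch'.
- exact: within_continuous_comp ck' ck.
Qed.

(** The values stay in the compact set [Z], and the graph condition leaves [h x] as the only cluster
    point at [x]; in a compact set this forces convergence. *)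
Lemma within_continuous_closed_graph (T : topologicalType) (V : T -> set T)
    (A Z : set T) (h : T -> T) :
  hausdorff_space T -> compact Z -> (forall x, nbhs x (V x)) ->
  (forall x, compact (V x)) ->
  (forall x, A x -> Z (h x)) ->
  (forall x y, A x ->
    (forall O, nbhs (x, y) O -> exists2 x', A x' & O (x', h x')) -> y = h x) ->
  {within A, continuous h}.
Proof.
move=> hT cZ nV cV AZ gr; apply/subspace_continuousP => x Ax.
have hP P : (h @ within A (nbhs x)) P -> P (h x).
  by move=> /nbhs_singleton; exact.
have FF : ProperFilter (h @ within A (nbhs x)).
  by split=> [/hP //|]; exact: fmap_filter.
(* The compact set has to be a neighborhood of the limit too, hence the union with [V (h x)]. *)
apply: (compact_cluster_set1 (V := Z `|` V (h x))) => //.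
- exact: compactU.
- by apply: filterS (nV (h x)) => y; right.
- rewrite /= /fmap /within /=; apply: nearW => y Ay; left; exact: AZ.
- apply/seteqP; split=> [y cy|_ ->].
  + apply: gr => // O [[B C] /= [nB nC] BC].
    have FB : (h @ within A (nbhs x)) [set h x' | x' in A `&` B].
      by rewrite /= /fmap /within /=; apply: filterS nB => x' Bx' Ax'; exists x'.
    have [_ [[x' [Ax' Bx'] <-] Cx']] := cy _ _ FB nC.
    by exists x' => //; exact: (BC (x', h x')).
  + by move=> P P' /hP Ph /nbhs_singleton P'h; exists (h x).
Qed.

(** The points reachable from [a] by [d]-chains form an open and closed set, hence all of [U].
    Compactness bounds the number of steps, so every coordinate of a sequence is reached in the same
    number of steps. *)
Lemma uniform_chains (R : realType) (U : metricType R) (a : U) (d : R) :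
  compact [set: U] -> connected [set: U] -> 0 < d ->
  forall P : control_seq U -> Prop, P (fun=> a) ->
    (forall u v, uclose d u v -> P u -> P v) -> forall u, P u.
Proof.
move=> cU conU d0 P Pa Puv.
pose reach := fix reach (m : nat) : set U :=
  if m is m'.+1 then [set b | exists2 b', reach m' b' & ball b' d b] else [set a].
have reachS m : reach m `<=` reach m.+1.
  by move=> b rb; exists b => //; exact: ballxx.
have reach_le m k : (m <= k)%N -> reach m `<=` reach k.
  move=> /subnK <-; elim: (k - m)%N => [//|j IH] b /IH; exact: reachS.
pose B := \bigcup_m reach m.
have BT : B = [set: U].
  apply: conU.
  - by exists a; exists 0%N.
  - exists B; last by rewrite setTI.
    rewrite openE => b [m _ mb]; apply/nbhs_ballP; exists d => //= b' bb'.
    by exists m.+1 => //; exists b.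
  - exists B; last by rewrite setTI.
    move=> b /(_ _ (nbhsx_ballx b d d0)) [b' [[m _ mb'] bb']].
    by exists m.+1 => //; exists b' => //; exact: ball_sym.
have [m rm] : exists m, forall b, reach m b.
  have : \forall m \near \oo, [set: U] `<=` reach m.
    move: cU => /compact_near_coveringP; apply => b _.
    have [k _ kb] : B b by rewrite BT.
    exists (ball b d, [set m | (k.+1 <= m)%N]) => /=.
      by split; [exact: nbhsx_ballx | exists k.+1].
    move=> [b' m] [/= bb' km]; apply: (reach_le _ _ km).
    by exists b.
  by move=> /filter_ex[m mT]; exists m => b; exact: mT.
suff H k (u : control_seq U) : (forall t, reach k (u t)) -> P u by move=> u; exact: (H m).
elim: k u => [|k IH] u uk.
  by have -> : u = (fun=> a) by apply/funext => t; exact: uk.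
have [v vP] := choice (fun t => let: ex_intro2 b h1 h2 := uk t in
  ex_intro (fun b => reach k b /\ ball b d (u t)) b (conj h1 h2)).
by apply: (Puv v u) => [t|]; [case: (vP t) | apply: IH => t; case: (vP t)].
Qed.

(** * Homeomorphisms between fibers *)

Section FiberHomeomorphism.
Variables (R : realType) (n : nat) (M : topologicalType).
Variables (A : smooth_manifold R n M) (g : riemannian_metric A).
Variables (U : metricType R) (S : control_system A U) (Q : set M).
Hypothesis U_compact : compact [set: U].
Hypothesis Q_hyperbolic : hyperbolic_set S g Q.
Hypothesis LQ_isolated : isolated_invariant S (all_time_lift S Q).

Let Q_compact : compact Q. Proof. by case: Q_hyperbolic. Qed.

(** Isolation provides a neighborhood in the product topology. Compactness of the control sequences
    and of [Q] makes it contain all pairs close to the lift, with closeness uniform in time for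
    controls. *)
Lemma isolating_radius : exists (N : set (control_seq U * M)) (d : R),
  [/\ forall z, (forall t, N (control_flow S t z)) -> all_time_lift S Q z,
      0 < d &
      diag_nbhs Q [set p | forall u v, all_time_lift S Q (u, p.1) ->
        uclose d u v -> N (v, p.2)]].
Proof.
case: LQ_isolated => clL _ [N [LN Nmax]].
have H x0 : Q x0 -> \forall p \near (x0, x0) & d \near (0 : R)^'+,
    forall u, [set: control_seq U] u -> forall v,
    all_time_lift S Q (u, p.1) -> uclose d u v -> N (v, p.2).
  move=> Qx0.
  pose F := filter_prod (nbhs (x0, x0)) (nbhs (0 : R)^'+).
  have /compact_near_coveringP cU := control_seq_compact U_compact.
  have := cU _ F (fun pd u => forall v, all_time_lift S Q (u, pd.1.1) ->
    uclose pd.2 u v -> N (v, pd.1.2)) _.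
  move=> h; have {h} : \forall pd \near F, [set: control_seq U] `<=`
      (fun u => forall v, all_time_lift S Q (u, pd.1.1) ->
        uclose pd.2 u v -> N (v, pd.1.2)).
    apply: h => u0 _.
    (* Off the lift, which is closed, the claim holds vacuously near [(u0, x0)]. *)
    have [Lu|nLu] := pselect (all_time_lift S Q (u0, x0)).
      have [[B C] /= [nB nC] BC] : nbhs (u0, x0) N by exact: LN.
      have [[B' D] /= [nB' nD] B'D] := near_uclose nB.
      exists (B', [set pd | C pd.1.2 /\ D pd.2]) => /=.
        split=> //.
        exists (snd @^-1` C, D) => /=.
          by split=> //; exact: (@cvg_snd _ _ (nbhs x0) (nbhs x0) _ _ nC).
        by move=> [p d] [].
      move=> [u [p d]] [/= B'u [Cp Dd]] v _ uv; apply: (BC (v, p.2)); split=> //.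
      exact: (B'D (u, d)).
    have : nbhs (u0, x0) (~` all_time_lift S Q).
      by apply: open_nbhs_nbhs; split=> //; exact: closed_openC.
    move=> [[B C] /= [nB nC] BC].
    exists (B, [set pd | C pd.1.1]) => /=.
      split=> //; exists (fst @^-1` C, setT) => /=.
        split; last exact: filterT.
        exact: (@cvg_fst _ _ (nbhs x0) (nbhs x0) _ _ nC).
      by move=> [p d] [].
    move=> [u [p d]] [/= Bu Cp] v Lup; exfalso.
    exact: (BC (u, p.1) (conj Bu Cp) Lup).
  by apply: filterS => -[p d] /= h u uT v; exact: h.
have : \forall d \near (0 : R)^'+, Q `<=` [set x | \forall p \near (x, x),
    forall u v, all_time_lift S Q (u, p.1) -> uclose d u v -> N (v, p.2)].
  move: Q_compact => /compact_near_coveringP; apply => x0 Qx0.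
  have [[B D] /= [nB nD] BD] := H x0 Qx0.
  exists ([set x | \forall p \near (x, x), B p], D) => /=.
    by split=> //; exact: near_diagonal.
  move=> [x d] [/= nBx Dd]; apply: filterS nBx => p Bp u v.
  exact: (BD (p, d)).
have d_gt0 : \forall d \near (0 : R)^'+, 0 < d by exact: nbhs_right_gt.
by move=> /(filterI d_gt0)/filter_ex[d [d0 dQ]]; exists N, d; split.
Qed.

Lemma shadowing (W : set (M * M)) (Z : set M) :
  diag_nbhs Q W -> closed W -> compact Z -> (forall p, W p -> Z p.2) ->
  exists2 d : R, 0 < d & forall u v x, all_time_lift S Q (u, x) ->
    uclose d u v -> exists y, forall t, W (phi S t x u, phi S t y v).
Proof.
move=> QW clW cZ WZ.
have [I [c [K [Ac Kc Kdom Kcov]]]] := finite_chart_cover A Q_compact.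
have [d d0 dP] := finite_shadowing U_compact Q_hyperbolic Ac Kc Kdom Kcov QW.
exists d => // u v x ux uv.
have window (N : nat) : exists y, forall t : int, (- N%:Z <= t <= N%:Z) ->
    W (phi S t x u, phi S t y v).
  (* A two-sided window of radius [N] is a forward window of length [N + N] for the controls shifted
     by [- N]. *)
  have [y yP] := dP (N + N)%N _ _ _ (lift_flow (- N%:Z) ux) (uclose_shift (- N%:Z) uv).
  exists (phi S N%:Z y (shift_seq (- N%:Z) v)) => t /andP[t1 t2].
  have [m tE mN] : exists2 m : nat, t + N%:Z = m%:Z & (m <= N + N)%N.
    by exists (absz (t + N%:Z)); lia.
  have := yP m mN; rewrite -tE -phiD addrK phiD shift_seqD addrN.
  by congr (W (_, phi S t _ _)); apply/funext => s; rewrite /shift_seq addr0.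
have [Y YP] := choice window.
have YZ : (Y @ \oo) Z.
  by exists 0%N => // N _; apply: (WZ _ (YP N 0 _)); lia.
have [y [_ cy]] := cZ (Y @ \oo) _ YZ.
exists y => t.
have clD : closed [set y' | W (phi S t x u, phi S t y' v)].
  apply: (@closed_comp _ _ (fun y' => (phi S t x u, phi S t y' v))) clW => y' _.
  apply: cvg_pair; first exact: cvg_cst.
  exact: phi_continuous.
apply: clD => O nO; apply: cy => //.
exists (absz t) => // N /= tN; apply: YP; lia.
Qed.

Lemma fiber_homeomorphic : exists2 d : R, 0 < d &
  forall u v, uclose d u v -> homeomorphic (fiber S Q u) (fiber S Q v).
Proof.
have [I [c [K [Ac Kc Kdom Kcov]]]] := finite_chart_cover A Q_compact.
have [W0 QW0 [d1 d10 exp0]] := expansivity U_compact Q_hyperbolic Ac Kc Kdom Kcov.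
have [N [d2 [Nmax d20 QN]]] := isolating_radius.
(* In [mapK] the reference orbit is that of [h x], which [x] shadows only through the reversed
   relation; hence the transposed neighborhood. *)
have QW0' : diag_nbhs Q [set p | W0 (p.2, p.1)].
  by move=> x Qx; apply: near_swap; exact: QW0.
have [W [Z [QW clW WW cZ WZ]]] := closed_diag_nbhs A Q_compact
  (diag_nbhsI QW0 (diag_nbhsI QW0' QN)).
have [d3 d30 shadow] := shadowing QW clW cZ WZ.
pose d := Num.min d1 (Num.min d2 d3).
exists d; first by rewrite !lt_min d10 d20 d30.
have dd1 : d <= d1 by rewrite ge_min lexx.
have dd2 : d <= d2 by rewrite !ge_min lexx orbT.
have dd3 : d <= d3 by rewrite !ge_min lexx !orbT.
have shadow_map u v : uclose d u v -> exists h : M -> M, forall x,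
    fiber S Q u x -> forall t, W (phi S t x u, phi S t (h x) v).
  move=> uv; have /choice[h hP] : forall x, exists y, fiber S Q u x ->
      forall t, W (phi S t x u, phi S t y v).
    move=> x; have [ux|nux] := pselect (fiber S Q u x); last by exists x.
    by have [y yP] := shadow _ _ _ ux (uclose_le dd3 uv); exists y.
  by exists h.
have map_fiber u v (h : M -> M) : uclose d u v ->
    (forall x, fiber S Q u x -> forall t, W (phi S t x u, phi S t (h x) v)) ->
    forall x, fiber S Q u x -> fiber S Q v (h x).
  move=> uv hP x ux; apply: Nmax => t.
  have [_ [_ WN]] := WW _ (hP x ux t).
  apply: (WN (shift_seq t u) (shift_seq t v)); first exact: lift_flow.
  by apply: uclose_shift; exact: uclose_le uv.
have uniq u v x y y' : uclose d u v -> fiber S Q u x ->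
    (forall t, W0 (phi S t x u, phi S t y v)) ->
    (forall t, W0 (phi S t x u, phi S t y' v)) -> y = y'.
  by move=> uv ux; apply: exp0 ux _; exact: uclose_le dd1 uv.
have mapK u v (h k : M -> M) : uclose d u v ->
    (forall x, fiber S Q u x -> forall t, W (phi S t x u, phi S t (h x) v)) ->
    (forall y, fiber S Q v y -> forall t, W (phi S t y v, phi S t (k y) u)) ->
    forall x, fiber S Q u x -> k (h x) = x.
  move=> uv hP kP x ux; have vh := map_fiber _ _ _ uv hP _ ux.
  apply: (uniq v u (h x)) => // [|t|t]; first exact: uclose_sym.
    by have [] := WW _ (kP _ vh t).
  by have [_ []] := WW _ (hP _ ux t).
have map_cont u v (h : M -> M) : uclose d u v ->
    (forall x, fiber S Q u x -> forall t, W (phi S t x u, phi S t (h x) v)) ->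
    {within fiber S Q u, continuous h}.
  move=> uv hP.
  have [V VP] := choice (compact_chart_neighborhood A).
  apply: (@within_continuous_closed_graph _ V _ Z _ (manifold_hausdorff A)) => //.
  - by move=> x; case: (VP x).
  - by move=> x; case: (VP x).
  - by move=> x ux; exact: (WZ _ (hP x ux 0)).
  - move=> x y ux gr; apply: (uniq u v x) => // t; last by have [] := WW _ (hP _ ux t).
    suff : W (phi S t x u, phi S t y v) by move=> /WW[].
    apply: clW => O nO.
    have cphi : {for (x, y), continuous (fun p : M * M =>
        (phi S t p.1 u, phi S t p.2 v))}.
      apply: cvg_pair.
        by apply: (@cvg_comp _ _ _ fst (phi S t ^~ u));
          [exact: cvg_fst|exact: phi_continuous].
      by apply: (@cvg_comp _ _ _ snd (phi S t ^~ v));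
        [exact: cvg_snd|exact: phi_continuous].
    have [x' ux' Ox'] := gr _ (cphi _ nO).
    by exists (phi S t x' u, phi S t (h x') v); split => //; exact: hP.
move=> u v uv; have vu := uclose_sym uv.
have [h hP] := shadow_map _ _ uv; have [k kP] := shadow_map _ _ vu.
exists h, k; split.
- by split; [exact: map_fiber uv hP | exact: map_fiber vu kP].
- by split; [exact: mapK uv hP kP | exact: mapK vu kP hP].
- exact: map_cont uv hP.
- exact: map_cont vu kP.
Qed.

End FiberHomeomorphism.

Theorem theorem3p7 (R : realType) (n : nat) (M : topologicalType)
    (A : smooth_manifold R n M) (M_connected : connected [set: M])
    (g : riemannian_metric A)
    (U : metricType R) (U_compact : compact [set: U])
    (U_connected : connected [set: U])
    (S : control_system A U) (Q : set M)
    (Q_hyperbolic : hyperbolic_set S g Q)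
    (LQ_isolated : isolated_invariant S (all_time_lift S Q)) :
  (forall u : control_seq U, fiber S Q u !=set0) /\
  (forall u v : control_seq U, homeomorphic (fiber S Q u) (fiber S Q v)).
Proof.
have [[x0 Qx0] _ inv _] := Q_hyperbolic.
have [u0 u0x0] := inv x0 Qx0.
have [d d0 dP] := fiber_homeomorphic U_compact Q_hyperbolic LQ_isolated.
(* Chains start at a constant sequence; [u0] provides a point of [U]. *)
pose a : control_seq U := fun=> u0 0.
have homeo_refl : homeomorphic (fiber S Q a) (fiber S Q a).
  by apply: dP => t; exact: ballxx.
have homeo_a u : homeomorphic (fiber S Q a) (fiber S Q u).
  apply: (uniform_chains U_compact U_connected d0
    (P := fun u => homeomorphic (fiber S Q a) (fiber S Q u))) homeo_refl _ u => v w vw hv.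
  exact: homeomorphic_trans hv (dP _ _ vw).
split=> u.
  (* The point [x0] of the fiber over [u0] is carried to the fiber over [u]. *)
  have [h [k [[h1 h2] _ _ _]]] :=
    homeomorphic_trans (homeomorphic_sym (homeo_a u0)) (homeo_a u).
  by exists (h x0); exact: h1.
by move=> v; exact: homeomorphic_trans (homeomorphic_sym (homeo_a u)) (homeo_a v).
Qed.
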